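(* Let $(M,J,g,\widetilde g)$ be an almost Norden manifold of dimension $2n$, with Levi-Civita connection $\nabla$ of $g$. Let $H=(J_1,J_2,J_3)$ be the triple of endomorphism fields on the tangent bundle $TM$ and $\widehat g$ the metric on $TM$ determined, for all vector fields $X,Y$ on $M$, by $$J_1X^H=-(JX)^H,\quad J_1X^V=(JX)^V,\quad J_2X^H=X^V,\quad J_2X^V=-X^H,\quad J_3X^H=(JX)^V,\quad J_3X^V=(JX)^H,$$ $$\widehat g(X^H,Y^H)=\widehat g(X^V,Y^V)=0,\qquad \widehat g(X^H,Y^V)=\widehat g(X^V,Y^H)=g(X,Y).$$ Then $TM$ equipped with $H$ and $\widehat g$ (and the derived forms $\widehat G=(\widehat g,\widehat\Phi,\widehat g_2,\widehat g_3)$) is an almost hypercomplex Hermitian-Norden manifold $(TM,H,\widehat G)$.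
   Context: An almost Norden manifold $(M^{2n},J,g,\widetilde g)$ is a smooth manifold with an almost complex structure $J$ ($J^2=-\mathrm{id}$) and a pseudo-Riemannian metric $g$ with $g(JX,JY)=-g(X,Y)$; the associated metric is $\widetilde g(X,Y)=g(X,JY)$. Both metrics have signature $(n,n)$. $X^H$ and $X^V$ denote the horizontal lift (with respect to the Levi-Civita connection $\nabla$ of $g$) and the vertical lift to $TM$ of a vector field $X$ on $M$. An almost hypercomplex structure on a $4n$-dimensional manifold is a triple $H=(J_1,J_2,J_3)$ of pairwise anticommuting almost complex structures with $J_3=J_1\circ J_2$. A Hermitian-Norden metric for $H$ is a pseudo-Riemannian metric $g$ of signature $(2n,2n)$ with $g(\cdot,\cdot)=g(J_1\cdot,J_1\cdot)=-g(J_2\cdot,J_2\cdot)=-g(J_3\cdot,J_3\cdot)$. It generates $G=(g,\Phi,g_2,g_3)$ with $\Phi=g(J_1\cdot,\cdot)$, $g_2=g(J_2\cdot,\cdot)$, $g_3=g(J_3\cdot,\cdot)$. A $4n$-dimensional manifold with such $(H,G)$ is called an almost hypercomplex Hermitian-Norden manifold. *)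

(* Defs.v *)
From mathcomp Require Import all_boot all_order all_algebra.
From mathcomp Require Import all_classical all_reals all_analysis.

Set Implicit Arguments.
Unset Strict Implicit.
Unset Printing Implicit Defensive.

Import Order.TTheory GRing.Theory Num.Theory.
Import numFieldNormedType.Exports.

Local Open Scope classical_set_scope.
Local Open Scope ring_scope.

(* A function of class C^k on an open set D of a finite-dimensional space. *)
Fixpoint class_C (R : realType) (V W : normedModType R) (k : nat)
    (D : set V) (f : V -> W) : Prop :=
  match k with
  | 0 => forall x, D x -> {for x, continuous f}
  | k'.+1 => (forall x, D x -> differentiable f x) /\
             (forall v : V, class_C k' D (fun x => 'D_v f x))
  end.

Definition smooth_on (R : realType) (V W : normedModType R)
    (D : set V) (f : V -> W) : Prop :=
  forall k, class_C k D f.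

(* The data of an m-dimensional atlas on a set M. Only the values of
   [chart_map i] on [chart_dom i], and of [chart_inv i] on the image of
   [chart_dom i], are meaningful. [chart_at p] is a preferred chart around p;
   it serves to represent tangent vectors. *)
Record atlas (R : realType) (m : nat) (M : Type) := Atlas {
  chart_index : Type;
  chart_dom : chart_index -> set M;
  chart_map : chart_index -> M -> 'rV[R]_m;
  chart_inv : chart_index -> 'rV[R]_m -> M;
  chart_at : M -> chart_index }.

Section Manifolds.
Variables (R : realType) (m : nat) (M : Type) (A : atlas R m M).
Implicit Types (i j : chart_index A) (p q : M) (U V : set M).

Definition chart_image i U : set 'rV[R]_m :=
  chart_map i @` (chart_dom i `&` U).

(* The topology of M is the one induced by the atlas. *)
Definition mopen U : Prop := forall i, open (chart_image i U).

Definition transition i j : 'rV[R]_m -> 'rV[R]_m :=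
  chart_map j \o chart_inv i.

Record smooth_manifold : Prop := SmoothManifold {
  chart_at_dom : forall p, chart_dom (chart_at A p) p;
  chart_mapK : forall i p, chart_dom i p -> chart_inv i (chart_map i p) = p;
  overlap_open : forall i j, open (chart_image i (chart_dom j));
  transition_smooth : forall i j,
    smooth_on (chart_image i (chart_dom j)) (transition i j);
  manifold_hausdorff : forall p q, p <> q ->
    exists U V, [/\ mopen U, mopen V, U p, V q & U `&` V = set0];
  manifold_second_countable : exists B : nat -> set M,
    (forall k, mopen (B k)) /\
    (forall U p, mopen U -> U p -> exists k, B k p /\ B k `<=` U) }.

(* The tangent space T_p M is 'rV[R]_m, a tangent vector being identified with
   its components in the chart [chart_at p]. The functions [to_chart] and
   [of_chart] are the changes of components from and to another chart i
   around p. *)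
Definition to_chart i p (v : 'rV[R]_m) : 'rV[R]_m :=
  'd (transition (chart_at A p) i) (chart_map (chart_at A p) p) v.

Definition of_chart i p (w : 'rV[R]_m) : 'rV[R]_m :=
  'd (transition i (chart_at A p)) (chart_map i p) w.

(* Not necessarily smooth: functions, vector fields, fields of endomorphisms of
   the tangent spaces, fields of forms on the tangent spaces. *)
Definition mfun := M -> R^o.
Definition vfield := M -> 'rV[R]_m.
Definition endofield := M -> 'rV[R]_m -> 'rV[R]_m.
Definition formfield := M -> 'rV[R]_m -> 'rV[R]_m -> R^o.

Definition vfield_coord i (X : vfield) (x : 'rV[R]_m) : 'rV[R]_m :=
  to_chart i (chart_inv i x) (X (chart_inv i x)).

(* The vector field with constant components w in the chart i. *)
Definition coord_vfield i (w : 'rV[R]_m) : vfield := fun p => of_chart i p w.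

Definition smooth_fun U (f : mfun) : Prop :=
  forall i, smooth_on (chart_image i U) (f \o chart_inv i).

Definition smooth_vfield U (X : vfield) : Prop :=
  forall i, smooth_on (chart_image i U) (vfield_coord i X).

Definition endo_app (J : endofield) (X : vfield) : vfield :=
  fun p => J p (X p).

Definition form_app (b : formfield) (X Y : vfield) : mfun :=
  fun p => b p (X p) (Y p).

Definition endo_tensor (J : endofield) : Prop := forall p, linear (J p).

Definition smooth_endo (J : endofield) : Prop :=
  endo_tensor J /\
  forall i w, smooth_on (chart_image i setT)
                (vfield_coord i (endo_app J (coord_vfield i w))).

Definition form_tensor (b : formfield) : Prop :=
  forall p, (forall w, scalar (fun v => b p v w)) /\ (forall v, scalar (b p v)).

Definition smooth_form (b : formfield) : Prop :=
  form_tensor b /\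
  forall i v w, smooth_on (chart_image i setT)
    (form_app b (coord_vfield i v) (coord_vfield i w) \o chart_inv i).

Record pseudo_riemannian (g : formfield) : Prop := PseudoRiemannian {
  metric_smooth : smooth_form g;
  metric_sym : forall p v w, g p v w = g p w v;
  metric_nondeg : forall p v, (forall w, g p v w = 0) -> v = 0 }.

(* At each point there is a basis (the rows of P) that is orthonormal for g,
   with r vectors of square 1 and s vectors of square -1. *)
Definition has_signature (g : formfield) (r s : nat) : Prop :=
  m = (r + s)%N /\
  forall p, exists P : 'M[R]_m, P \in unitmx /\
    forall a b : 'I_m, g p (row a P) (row b P) =
      if a == b then (if (a < r)%N then 1 else -1) else 0.

Definition almost_complex (J : endofield) : Prop :=
  smooth_endo J /\ forall p v, J p (J p v) = - v.

(* X f *)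
Definition vfield_deriv (X : vfield) (f : mfun) : mfun := fun p =>
  'd (f \o chart_inv (chart_at A p)) (chart_map (chart_at A p) p) (X p).

(* [X, Y] *)
Definition lie_bracket (X Y : vfield) : vfield := fun p =>
  let i := chart_at A p in
  'd (vfield_coord i Y) (chart_map i p) (X p) -
  'd (vfield_coord i X) (chart_map i p) (Y p).

(* A linear connection acts on vector fields defined on open subsets of M. As
   vector fields are total functions here, only the values of [nabla X Y] at
   points near which X and Y are smooth are specified. *)
Record linear_connection (nabla : vfield -> vfield -> vfield) : Prop :=
  LinearConnection {
  nabla_smooth : forall U X Y, mopen U ->
    smooth_vfield U X -> smooth_vfield U Y -> smooth_vfield U (nabla X Y);
  nabla_linl : forall U (f : mfun) X X' Y, mopen U -> smooth_fun U f ->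
    smooth_vfield U X -> smooth_vfield U X' -> smooth_vfield U Y ->
    forall p, U p ->
    nabla (fun q => f q *: X q + X' q) Y p = f p *: nabla X Y p + nabla X' Y p;
  nabla_addr : forall U X Y Y', mopen U ->
    smooth_vfield U X -> smooth_vfield U Y -> smooth_vfield U Y' ->
    forall p, U p ->
    nabla X (fun q => Y q + Y' q) p = nabla X Y p + nabla X Y' p;
  nabla_leibniz : forall U (f : mfun) X Y, mopen U -> smooth_fun U f ->
    smooth_vfield U X -> smooth_vfield U Y ->
    forall p, U p ->
    nabla X (fun q => f q *: Y q) p =
      vfield_deriv X f p *: Y p + f p *: nabla X Y p }.

Record levi_civita (g : formfield) (nabla : vfield -> vfield -> vfield) :
    Prop := LeviCivita {
  levi_civita_connection : linear_connection nabla;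
  levi_civita_torsion : forall U X Y, mopen U ->
    smooth_vfield U X -> smooth_vfield U Y ->
    forall p, U p -> nabla X Y p - nabla Y X p = lie_bracket X Y p;
  levi_civita_metric : forall U X Y Z, mopen U ->
    smooth_vfield U X -> smooth_vfield U Y -> smooth_vfield U Z ->
    forall p, U p ->
    vfield_deriv X (form_app g Y Z) p =
      g p (nabla X Y p) (Z p) + g p (Y p) (nabla X Z p) }.

End Manifolds.

Arguments mfun : clear implicits.
Arguments vfield : clear implicits.
Arguments endofield : clear implicits.
Arguments formfield : clear implicits.

Record almost_norden (R : realType) (n : nat) (M : Type)
    (A : atlas R (2 * n) M) (J : endofield R (2 * n) M)
    (g gt : formfield R (2 * n) M) : Prop := AlmostNorden {
  norden_manifold : smooth_manifold A;
  norden_complex : almost_complex A J;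
  norden_metric : pseudo_riemannian A g;
  norden_compat : forall p v w, g p (J p v) (J p w) = - g p v w;
  norden_assoc : forall p v w, gt p v w = g p v (J p w) }.

Record almost_hypercomplex (R : realType) (m : nat) (M : Type)
    (A : atlas R m M) (J1 J2 J3 : endofield R m M) : Prop :=
  AlmostHypercomplex {
  hypercomplex1 : almost_complex A J1;
  hypercomplex2 : almost_complex A J2;
  hypercomplex3 : almost_complex A J3;
  hypercomplex12 : forall p v, J1 p (J2 p v) = - J2 p (J1 p v);
  hypercomplex13 : forall p v, J1 p (J3 p v) = - J3 p (J1 p v);
  hypercomplex23 : forall p v, J2 p (J3 p v) = - J3 p (J2 p v);
  hypercomplexE : forall p v, J3 p v = J1 p (J2 p v) }.

Record hermitian_norden_metric (R : realType) (n m : nat) (M : Type)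
    (A : atlas R m M) (J1 J2 J3 : endofield R m M) (g : formfield R m M) :
    Prop := HermitianNordenMetric {
  hn_metric : pseudo_riemannian A g;
  hn_signature : has_signature g (2 * n) (2 * n);
  hn_compat1 : forall p v w, g p v w = g p (J1 p v) (J1 p w);
  hn_compat2 : forall p v w, g p v w = - g p (J2 p v) (J2 p w);
  hn_compat3 : forall p v w, g p v w = - g p (J3 p v) (J3 p w) }.

Definition first_arg_form (R : realType) (m : nat) (M : Type)
    (J : endofield R m M) (g : formfield R m M) : formfield R m M :=
  fun p v w => g p (J p v) w.

Record almost_hypercomplex_hermitian_norden (R : realType) (n m : nat)
    (M : Type) (A : atlas R m M) (J1 J2 J3 : endofield R m M)
    (g Phi g2 g3 : formfield R m M) : Prop := AlmostHypercomplexHN {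
  ahhn_manifold : smooth_manifold A;
  ahhn_dim : m = (4 * n)%N;
  ahhn_hypercomplex : almost_hypercomplex A J1 J2 J3;
  ahhn_metric : hermitian_norden_metric n A J1 J2 J3 g;
  ahhn_Phi : Phi = first_arg_form J1 g;
  ahhn_g2 : g2 = first_arg_form J2 g;
  ahhn_g3 : g3 = first_arg_form J3 g }.

Section TangentBundle.
Variables (R : realType) (m : nat) (M : Type) (A : atlas R m M).

(* As a set, the disjoint union of the T_p M. *)
Definition tbundle : Type := (M * 'rV[R]_m)%type.

(* The chart i of M induces on TM the chart sending (p, v) to the coordinates
   of p followed by the components of v, with respect to i. *)
Definition tbundle_atlas : atlas R (m + m) tbundle :=
  @Atlas R (m + m) tbundle (chart_index A)
    (fun i => [set u | chart_dom i u.1])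
    (fun i u => row_mx (chart_map i u.1) (to_chart i u.1 u.2))
    (fun i z => (chart_inv i (lsubmx z),
                 of_chart i (chart_inv i (lsubmx z)) (rsubmx z)))
    (fun u => chart_at A u.1).

Definition vlift (X : vfield R m M) : vfield R (m + m) tbundle :=
  fun u => row_mx 0 (X u.1).

(* In the coordinates (x, y) induced by a chart, the horizontal lift of X is
   X^a d/dx^a - X^a y^b Gamma_ab^c d/dy^c, and at a point y of TM the vector
   X^a y^b Gamma_ab^c d/dx^c is nabla_X Y for the vector field Y with constant
   components y. *)
Definition hlift (nabla : vfield R m M -> vfield R m M -> vfield R m M)
    (X : vfield R m M) : vfield R (m + m) tbundle :=
  fun u => row_mx (X u.1)
    (- nabla X (coord_vfield (A := A) (chart_at A u.1) u.2) u.1).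

Record lifted_structure (nabla : vfield R m M -> vfield R m M -> vfield R m M)
    (J : endofield R m M) (g : formfield R m M)
    (J1 J2 J3 : endofield R (m + m) tbundle)
    (gh : formfield R (m + m) tbundle) : Prop := LiftedStructure {
  lifted_J1_tensor : endo_tensor J1;
  lifted_J2_tensor : endo_tensor J2;
  lifted_J3_tensor : endo_tensor J3;
  lifted_metric_tensor : form_tensor gh;
  lifted_J : forall (U : set M) (X : vfield R m M), mopen A U ->
    smooth_vfield A U X -> forall u : tbundle, U u.1 ->
    [/\ J1 u (hlift nabla X u) = - hlift nabla (endo_app J X) u /\
        J1 u (vlift X u) = vlift (endo_app J X) u,
        J2 u (hlift nabla X u) = vlift X u /\
        J2 u (vlift X u) = - hlift nabla X u
      & J3 u (hlift nabla X u) = vlift (endo_app J X) u /\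
        J3 u (vlift X u) = hlift nabla (endo_app J X) u];
  lifted_metric : forall (U : set M) (X Y : vfield R m M), mopen A U ->
    smooth_vfield A U X -> smooth_vfield A U Y -> forall u : tbundle, U u.1 ->
    [/\ gh u (hlift nabla X u) (hlift nabla Y u) = 0,
        gh u (vlift X u) (vlift Y u) = 0,
        gh u (hlift nabla X u) (vlift Y u) = g u.1 (X u.1) (Y u.1)
      & gh u (vlift X u) (hlift nabla Y u) = g u.1 (X u.1) (Y u.1)] }.

End TangentBundle.

Arguments tbundle : clear implicits.

(* Main.v *)
(* At each point u = (p, y) of TM, every tangent vector is uniquely the sum of
   a horizontal lift of some h and a vertical lift of some v in T_p M, so the
   required tensors are determined by, and defined through, the pair (h, v);
   the algebraic identities then hold because J^2 = -1 and g(J., J.) = -g.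
   Smoothness is checked in a chart induced by a chart of M, where the pair
   (h, v) becomes (a, b - Gamma(a, y)): the second derivatives of the transition
   maps of M in the differential of those of TM cancel those in the
   transformation law of the Christoffel symbols Gamma. *)

From HB Require Import structures.
Require Import Defs.
From mathcomp Require Import all_boot all_order all_algebra.
From mathcomp Require Import all_classical all_reals all_analysis.

Set Implicit Arguments.
Unset Strict Implicit.
Unset Printing Implicit Defensive.

Import Order.TTheory GRing.Theory Num.Theory.
Import numFieldNormedType.Exports.

Local Open Scope classical_set_scope.
Local Open Scope ring_scope.

(** A tangent vector is stored as its components in [chart_at p], and this choice may jump from
    point to point, so the raw components of a smooth field need not be continuous. Every smoothness
    statement is therefore read in one fixed chart [i], through [to_chart] and [of_chart], and the
    horizontal and vertical parts need a description of the same shape in all charts. A second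
    obstacle is that a connection acts on total functions while its laws hold only where the fields
    are smooth: locality has to be derived before a field can be expanded in coordinate fields,
    which exist on a chart domain only. Smoothness proofs mostly reduce to one principle: a family
    of linear maps that is smooth on each fixed vector is smooth on a smoothly varying vector. *)

Section ClassC.

(** * Calculus of maps of class C^k *)

Context {R : realType}.
Implicit Types V W : normedModType R.

Lemma near_of_open {T : topologicalType} (D : set T) x (P : T -> Prop) :
  open D -> D x -> (forall y, D y -> P y) -> \forall y \near x, P y.
Proof. by move=> oD Dx DP; apply: filterS (open_nbhs_nbhs (conj oD Dx)). Qed.

(** The differential is the only continuous linear map occurring in a first-order expansion at [x],
    and such an expansion depends on the germ at [x] alone. *)
Lemma near_eq_differentiable V W (f g : V -> W) x :
  (\forall y \near x, f y = g y) -> differentiable f x ->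
  differentiable g x /\ 'd g x = 'd f x :> (V -> W).
Proof.
move=> fg df.
have [dc] : continuous ('d f x) /\
    g \o shift x = cst (g x) + 'd f x +o_ 0 id.
  split; first exact: diff_continuous.
  apply/eqaddoP => _/posnumP[e].
  have /eqaddoP/(_ e%:num (gt0 e)) H := diff_locally df.
  have fg0 : \forall y \near 0, f (y + x) = g (y + x).
    by move: fg; rewrite [X in X -> _](near_shift 0) subr0.
  have fgx := nbhs_singleton fg.
  by apply: filterS2 fg0 H => y; rewrite !fctE /= fgx => ->.
move=> H; have E := diff_unique dc H.
by split => //; apply/diff_locallyP; rewrite E.
Qed.

(** [class_C] asks for continuity and differentiability in the ambient space, not relative to [D];
    openness turns equality on [D] into equality near each point. *)
Lemma class_C_eq V W k (D : set V) (f g : V -> W) : open D ->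
  (forall x, D x -> f x = g x) -> class_C k D f -> class_C k D g.
Proof.
elim: k f g => [|k IHk] f g oD fg /=.
  move=> cf x Dx; rewrite /prop_for /continuous_at -(fg x Dx).
  apply: cvg_trans (cf x Dx); apply: near_eq_cvg.
  by apply: near_of_open oD Dx _ => y Dy /=; rewrite fg.
move=> [df Df]; split=> [x Dx|v].
  by apply: (near_eq_differentiable _ (df x Dx)).1; apply: near_of_open oD Dx fg.
apply: IHk (Df v) => // x Dx; apply: near_eq_derive.
exact: near_of_open oD Dx fg.
Qed.

Lemma class_CW V W k (D : set V) (f : V -> W) : class_C k.+1 D f -> class_C k D f.
Proof.
elim: k f => [|k IHk] f [df Df].
  by move=> x Dx; apply: differentiable_continuous; apply: df.
by split=> // v; apply: IHk; apply: Df.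
Qed.

Lemma class_C_sub V W k (D E : set V) (f : V -> W) :
  E `<=` D -> class_C k D f -> class_C k E f.
Proof.
elim: k f => [|k IHk] f ED /=; first by move=> cf x /ED; apply: cf.
by move=> [df Df]; split=> [x /ED|v]; [apply: df|apply: IHk].
Qed.

Lemma class_C_cst V W k (D : set V) (a : W) : class_C k D (fun=> a).
Proof.
elim: k a => [|k IHk] a /=; first by move=> x _; apply: cst_continuous.
split=> [x _|v]; first exact: differentiable_cst.
suff -> : (fun x => 'D_v (fun=> a) x) = (fun=> 0 : W) by [].
by apply/funext => x; apply: derive_cst.
Qed.

Lemma class_C_add V W k (D : set V) (f g : V -> W) : open D ->
  class_C k D f -> class_C k D g -> class_C k D (fun x => f x + g x).
Proof.
move=> oD; elim: k f g => [|k IHk] f g /=.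
  by move=> cf cg x Dx; apply: continuousD; [apply: cf|apply: cg].
move=> [df Df] [dg Dg]; split=> [x Dx|v].
  by apply: differentiableD; [apply: df|apply: dg].
apply: class_C_eq (IHk _ _ (Df v) (Dg v)) => // x Dx /=.
rewrite -deriveD //; apply: diff_derivable; [exact: df|exact: dg].
Qed.

Lemma class_C_lin V W W' k (D : set V) (L : {linear W -> W'}) (f : V -> W) :
  open D -> continuous L -> class_C k D f -> class_C k D (fun x => L (f x)).
Proof.
move=> oD cL; elim: k f => [|k IHk] f /=.
  by move=> cf x Dx; apply: continuous_comp; [apply: cf|apply: cL].
move=> [df Df].
have dL y : differentiable L y by apply: linear_differentiable.
split=> [x Dx|v]; first by apply: differentiable_comp; [apply: df|].
apply: class_C_eq (IHk _ (Df v)) => // x Dx /=.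
have dfx := df x Dx.
rewrite !deriveE //; last exact: (differentiable_comp dfx (dL _)).
by rewrite (diff_comp dfx (dL _)) /= diff_lin.
Qed.

Lemma scale_is_bilinear W : bilinear_for
  (GRing.Scale.Law.clone _ _ *:%R _) (GRing.Scale.Law.clone _ _ *:%R _)
  (fun (a : R^o) (w : W) => a *: w).
Proof.
split=> [w|b] a x y /=; first by rewrite scalerDl scalerA.
by rewrite scalerDr !scalerA mulrC.
Qed.

(** Scaling is a continuous bilinear map, so the Leibniz rule is the chain rule for it after
    [y |-> (f y, g y)]. *)
Lemma diff_scale V W (f : V -> R^o) (g : V -> W) x :
  differentiable f x -> differentiable g x ->
  differentiable (fun y => f y *: g y) x /\
  forall v, 'd (fun y => f y *: g y) x v = f x *: 'd g x v + 'd f x v *: g x.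
Proof.
move=> df dg.
pose B : {bilinear R^o -> W -> W} := HB.pack (fun (a : R^o) (w : W) => a *: w)
  (bilinear_isBilinear.Build _ _ _ _ _ _ _ (scale_is_bilinear W)).
have cB : continuous (fun p => B p.1 p.2) by apply: scale_continuous.
have dp := differentiable_pair df dg.
have dB := differentiable_bilin (f x, g x) cB.
split=> [|v]; first exact: (differentiable_comp dp dB).
rewrite -[fun y => _]/((fun p => B p.1 p.2) \o (fun y => (f y, g y))).
rewrite (diff_comp dp dB) /= (diff_pair df dg).
by rewrite (diff_bilin _ cB).
Qed.

Lemma class_C_scale V W k (D : set V) (f : V -> R^o) (g : V -> W) :
  open D -> class_C k D f -> class_C k D g -> class_C k D (fun x => f x *: g x).
Proof.
move=> oD; elim: k f g => [|k IHk] f g.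
  by move=> cf cg x Dx; apply: continuousZ; [apply: cf|apply: cg].
move=> Cf Cg; case: (Cf) (Cg) => [df Df] [dg Dg].
split=> [x Dx|v]; first exact: (diff_scale (df x Dx) (dg x Dx)).1.
apply: class_C_eq (class_C_add oD (IHk _ _ (class_CW Cf) (Dg v))
  (IHk _ _ (Df v) (class_CW Cg))) => // x Dx /=.
have [dfx dgx] := (df x Dx, dg x Dx).
by have [dfg E] := diff_scale dfx dgx; rewrite !deriveE.
Qed.

Lemma class_C_sum V W k (D : set V) (I : Type) (r : seq I) (f : I -> V -> W) :
  open D -> (forall i, class_C k D (f i)) ->
  class_C k D (fun x => \sum_(i <- r) f i x).
Proof.
move=> oD Cf; elim: r => [|i r IHr].
  by apply: class_C_eq (class_C_cst _ _ 0) => // x _; rewrite big_nil.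
apply: class_C_eq (class_C_add oD (Cf i) IHr) => // x _.
by rewrite big_cons.
Qed.

Lemma class_C_coord V n k (D : set V) (f : V -> 'rV[R]_n) j : open D ->
  class_C k D f -> class_C k D (fun x => f x 0 j : R^o).
Proof.
move=> oD.
have lc : linear (fun u : 'rV[R]_n => u 0 j : R^o) by move=> a u v; rewrite !mxE.
pose L : {linear 'rV[R]_n -> R^o} := HB.pack (fun u : 'rV[R]_n => u 0 j : R^o)
  (GRing.isLinear.Build _ _ _ _ _ lc).
by apply: (@class_C_lin _ _ _ _ _ L) => //; apply: coord_continuous.
Qed.

Lemma class_C_id V k (D : set V) : class_C k D (@idfun V).
Proof.
case: k => [|k] /=; first by move=> x _ A.
split=> [x _|v]; first by have [] := is_diff_id x.
suff -> : (fun x : V => 'D_v idfun x) = (fun=> v) by apply: class_C_cst.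
by apply/funext => x; apply: derive_id.
Qed.

(** By the chain rule, the derivative of [f \o h] along [v] is a sum of coordinates of ['D_v h]
    times partial derivatives of [f] composed with [h]; the induction hypothesis, general in [f],
    applies to the latter. The middle space consists of rows to provide the finite basis. *)
Lemma class_C_comp V W n k (D : set V) (E : set 'rV[R]_n)
    (h : V -> 'rV[R]_n) (f : 'rV[R]_n -> W) :
  open D -> (forall x, D x -> E (h x)) ->
  class_C k D h -> class_C k E f -> class_C k D (f \o h).
Proof.
move=> oD DE; elim: k f => [|k IHk] f.
  move=> ch cf x Dx; apply: continuous_comp; first exact: ch.
  by apply: cf; apply: DE.
move=> Ch Cf; case: (Ch) (Cf) => [dh Dh] [df Df]; split=> [x Dx|v].
  by apply: differentiable_comp; [apply: dh|apply/df/DE].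
apply: (@class_C_eq _ _ _ _ (fun x => \sum_j
  ('D_v h x) 0 j *: (fun y => 'D_(delta_mx 0 j) f y) (h x))) => //.
  move=> x Dx; have [dhx dfx] := (dh x Dx, df _ (DE x Dx)).
  rewrite (deriveE v (differentiable_comp dhx dfx)) (diff_comp dhx dfx) /=.
  rewrite [in RHS](row_sum_delta ('d h x v)) linear_sum.
  by apply: eq_bigr => j _; rewrite linearZ !deriveE.
apply: class_C_sum => // j; apply: class_C_scale => //.
  by have := class_C_coord j oD (Dh v).
by have := IHk _ (class_CW Ch) (Df (delta_mx 0 j)).
Qed.

End ClassC.

(* Otherwise a failing unification unfolds the epsilon term in ['d f x]. *)
Local Opaque diff.

(** * Functions known to be linear only through a hypothesis *)

Section LinearFacts.
Context {R : pzRingType} {U V : lmodType R} (L : U -> V).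
Hypothesis lL : linear L.

Lemma linear_add u v : L (u + v) = L u + L v.
Proof. by have := lL 1 u v; rewrite !scale1r. Qed.

Lemma linear_zero : L 0 = 0.
Proof. by have := lL (-1) 0 0; rewrite scaler0 addr0 scaleN1r addNr. Qed.

Lemma linear_scale c u : L (c *: u) = c *: L u.
Proof. by have := lL c u 0; rewrite !addr0 linear_zero addr0. Qed.

Lemma linear_neg u : L (- u) = - L u.
Proof. by rewrite -!scaleN1r linear_scale. Qed.

End LinearFacts.

(** * Smooth maps, and smooth families of linear maps *)

Section SmoothOn.
Context {R : realType}.
Implicit Types V W : normedModType R.

Lemma open_preimage_on {T T' : topologicalType} (D : set T) (O : set T') (f : T -> T') :
  open D -> open O -> (forall x, D x -> {for x, continuous f}) ->
  open (D `&` f @^-1` O).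
Proof.
rewrite !openE => oD oO cf x [Dx Ofx]; apply: filterI; first exact: oD.
by apply: cf => //; apply: oO.
Qed.

Lemma smooth_on_eq V W (D : set V) (f g : V -> W) : open D ->
  (forall x, D x -> f x = g x) -> smooth_on D f -> smooth_on D g.
Proof. by move=> oD fg Cf k; apply: class_C_eq (Cf k). Qed.

Lemma smooth_onW V W (D E : set V) (f : V -> W) :
  E `<=` D -> smooth_on D f -> smooth_on E f.
Proof. by move=> ED Cf k; apply: class_C_sub (Cf k). Qed.

Lemma smooth_on_cst V W (D : set V) (a : W) : smooth_on D (fun=> a).
Proof. by move=> k; apply: class_C_cst. Qed.

Lemma smooth_on_id V (D : set V) : smooth_on D (@idfun V).
Proof. by move=> k; apply: class_C_id. Qed.

Lemma smooth_on_add V W (D : set V) (f g : V -> W) : open D ->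
  smooth_on D f -> smooth_on D g -> smooth_on D (fun x => f x + g x).
Proof. by move=> oD Cf Cg k; apply: class_C_add. Qed.

Lemma smooth_on_scale V W (D : set V) (f : V -> R^o) (g : V -> W) : open D ->
  smooth_on D f -> smooth_on D g -> smooth_on D (fun x => f x *: g x).
Proof. by move=> oD Cf Cg k; apply: class_C_scale. Qed.

Lemma smooth_on_opp V W (D : set V) (f : V -> W) : open D ->
  smooth_on D f -> smooth_on D (fun x => - f x).
Proof.
move=> oD Cf; apply: smooth_on_eq (smooth_on_scale oD (@smooth_on_cst _ R^o D (-1)) Cf) => //.
by move=> x _; rewrite scaleN1r.
Qed.

Lemma smooth_on_coord V n (D : set V) (f : V -> 'rV[R]_n) j : open D ->
  smooth_on D f -> smooth_on D (fun x => f x 0 j : R^o).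
Proof. by move=> oD Cf k; apply: class_C_coord. Qed.

Lemma smooth_on_sum V W (D : set V) (I : Type) (r : seq I) (f : I -> V -> W) :
  open D -> (forall i, smooth_on D (f i)) ->
  smooth_on D (fun x => \sum_(i <- r) f i x).
Proof. by move=> oD Cf k; apply: class_C_sum => // i; apply: Cf. Qed.

Lemma smooth_on_comp V W n (D : set V) (E : set 'rV[R]_n)
    (h : V -> 'rV[R]_n) (f : 'rV[R]_n -> W) :
  open D -> (forall x, D x -> E (h x)) ->
  smooth_on D h -> smooth_on E f -> smooth_on D (f \o h).
Proof. by move=> oD DE Ch Cf k; apply: class_C_comp DE (Ch k) (Cf k). Qed.

Lemma smooth_on_continuous V W (D : set V) (f : V -> W) :
  smooth_on D f -> forall x, D x -> {for x, continuous f}.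
Proof. by move=> /(_ 0%N). Qed.

Lemma smooth_on_differentiable V W (D : set V) (f : V -> W) :
  smooth_on D f -> forall x, D x -> differentiable f x.
Proof. by move=> /(_ 1%N) []. Qed.

Lemma smooth_on_diff V W (D : set V) (f : V -> W) v : open D ->
  smooth_on D f -> smooth_on D (fun x => 'd f x v).
Proof.
move=> oD Cf; apply: (@smooth_on_eq _ _ _ (fun x => 'D_v f x)) => //.
  by move=> x Dx; rewrite deriveE //; apply: smooth_on_differentiable Dx.
by move=> k; have [_] := Cf k.+1; apply.
Qed.

Lemma linear_expand (U W : lmodType R) (L : U -> W) (I : Type) (r : seq I)
    (c : I -> R) (u : I -> U) : linear L ->
  L (\sum_(i <- r) c i *: u i) = \sum_(i <- r) c i *: L (u i).
Proof.
move=> lL.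
pose K : {linear U -> W} := HB.pack L (GRing.isLinear.Build _ _ _ _ _ lL).
rewrite -[L]/(K : _ -> _) linear_sum; apply: eq_bigr => i _; exact: linearZ.
Qed.

Lemma linear_row_expand n (W : lmodType R) (L : 'rV[R]_n -> W) w : linear L ->
  L w = \sum_j w 0 j *: L (delta_mx 0 j).
Proof. by move=> lL; rewrite {1}(row_sum_delta w) linear_expand. Qed.

(** Expanding [w x] in the standard basis leaves products of its coordinates with the smooth
    functions [F x (delta_mx 0 j)]. This passes from tensors tested on constant components to
    varying arguments. *)
Lemma smooth_on_family V W n (D : set V) (F : V -> 'rV[R]_n -> W)
    (w : V -> 'rV[R]_n) : open D -> (forall x, D x -> linear (F x)) ->
  (forall v, smooth_on D (fun x => F x v)) -> smooth_on D w ->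
  smooth_on D (fun x => F x (w x)).
Proof.
move=> oD lF CF Cw.
apply: (@smooth_on_eq _ _ _
  (fun x => \sum_j w x 0 j *: F x (delta_mx 0 j))) => //.
  by move=> x Dx; rewrite -linear_row_expand //; apply: lF.
apply: smooth_on_sum => // j; apply: smooth_on_scale => //.
exact: smooth_on_coord.
Qed.

Lemma smooth_on_linear V W n (D : set V) (L : 'rV[R]_n -> W)
    (w : V -> 'rV[R]_n) : open D -> linear L -> smooth_on D w ->
  smooth_on D (fun x => L (w x)).
Proof.
move=> oD lL; apply: (@smooth_on_family _ _ _ _ (fun=> L)) => // v.
exact: smooth_on_cst.
Qed.

Lemma diff_eq_on V W (D : set V) (f g : V -> W) x v : open D ->
  (forall y, D y -> f y = g y) -> D x -> differentiable f x ->
  'd g x v = 'd f x v.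
Proof.
move=> oD fg Dx df.
by rewrite (near_eq_differentiable _ df).2 //; apply: near_of_open oD Dx fg.
Qed.

Lemma linear_differential V W (f : V -> W) x : linear ('d f x).
Proof. exact: linearP. Qed.

End SmoothOn.

(** * Charts, changes of components and local vector fields *)

Section Charts.
Context {R : realType} {m : nat} {M : Type} (A : atlas R m M).
Implicit Types (i j k : chart_index A) (p q : M) (U V : set M).

(** A smooth manifold without its two topological axioms. For the tangent bundle this part is
    established first, so that the chart lemmas are available when proving that the bundle is
    Hausdorff and second countable. *)
Record smooth_atlas : Prop := SmoothAtlas {
  atlas_at : forall p, chart_dom (chart_at A p) p;
  atlas_mapK : forall i p, chart_dom i p -> chart_inv i (chart_map i p) = p;
  atlas_overlap : forall i j, open (chart_image i (chart_dom j));
  atlas_transition : forall i j,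
    smooth_on (chart_image i (chart_dom j)) (transition i j) }.

Arguments atlas_overlap : clear implicits.
Arguments atlas_transition : clear implicits.

Hypothesis SA : smooth_atlas.

Lemma chart_image_map i U p : chart_dom i p -> U p -> chart_image i U (chart_map i p).
Proof. by move=> ip Up; exists p. Qed.

Lemma chart_image_inv i U x : chart_image i U x ->
  [/\ chart_dom i (chart_inv i x), U (chart_inv i x) &
      chart_map i (chart_inv i x) = x].
Proof. by move=> [p [ip Up] <-]; rewrite (atlas_mapK SA). Qed.

Lemma chart_image_setI i U V :
  chart_image i (U `&` V) = chart_image i U `&` chart_image i V.
Proof.
apply/seteqP; split=> x /=.
  by move=> [p [ip [Up Vp]] <-]; split; apply: chart_image_map.
move=> [[p [ip Up] <-] /chart_image_inv[_]].
by rewrite (atlas_mapK SA ip) => Vp _; apply: chart_image_map.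
Qed.

Lemma chart_imageS i U V : U `<=` V -> chart_image i U `<=` chart_image i V.
Proof. by move=> UV x [p [ip Up] <-]; apply: chart_image_map => //; apply: UV. Qed.

Lemma chart_image_dom i U : chart_image i U `<=` chart_image i (chart_dom i).
Proof. by move=> x [p [ip Up] <-]; apply: chart_image_map. Qed.

Lemma chart_imageT i : chart_image i setT = chart_image i (chart_dom i).
Proof.
apply/seteqP; split; first exact: chart_image_dom.
by apply: chart_imageS.
Qed.

Lemma open_chart_image i : open (chart_image i setT).
Proof. by rewrite chart_imageT; apply: atlas_overlap. Qed.

Lemma mopen_dom i : mopen A (chart_dom i).
Proof. by move=> j; apply: atlas_overlap. Qed.

Lemma mopenT : mopen A setT.
Proof. by move=> j; apply: open_chart_image. Qed.

Lemma mopenI U V : mopen A U -> mopen A V -> mopen A (U `&` V).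
Proof. by move=> oU oV i; rewrite chart_image_setI; apply: openI. Qed.

Lemma transition_map i j p : chart_dom i p ->
  transition i j (chart_map i p) = chart_map j p.
Proof. by move=> ip; rewrite /transition /= (atlas_mapK SA). Qed.

Lemma transition_differentiable i j p : chart_dom i p -> chart_dom j p ->
  differentiable (transition i j) (chart_map i p).
Proof.
move=> ip jp; apply: smooth_on_differentiable (atlas_transition SA i j) _ _.
exact: chart_image_map.
Qed.

Lemma transition_trans i j k x : chart_image i (chart_dom j) x ->
  transition j k (transition i j x) = transition i k x.
Proof. by move=> [p [ip jp] <-]; rewrite !transition_map. Qed.

(** The chain rule for the cocycle identity of transition maps, which holds only on an open overlap.
    Taking [chart_at A p] for one of the charts gives the rules for [to_chart] and [of_chart]. *)
Lemma diff_transition_trans i j k p v :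
  chart_dom i p -> chart_dom j p -> chart_dom k p ->
  'd (transition j k) (chart_map j p) ('d (transition i j) (chart_map i p) v) =
  'd (transition i k) (chart_map i p) v.
Proof.
move=> ip jp kp.
have dij := transition_differentiable ip jp.
have djk : differentiable (transition j k) (transition i j (chart_map i p)).
  rewrite (transition_map j ip); exact: transition_differentiable.
have dik := transition_differentiable ip kp.
have E y : chart_image i (chart_dom j) y ->
    transition i k y = (transition j k \o transition i j) y.
  by move=> /(transition_trans k).
apply: etrans (diff_eq_on v (atlas_overlap SA i j) E (chart_image_map ip jp) dik).
apply: esym; apply: etrans (congr1 (fun h => h v) (diff_comp dij djk)) _.
by rewrite /= (transition_map j ip).
Qed.

Lemma diff_transition_id i p v : chart_dom i p ->
  'd (transition i i) (chart_map i p) v = v.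
Proof.
move=> ip; have [di ei] := is_diff_id (chart_map i p).
have E y : chart_image i (chart_dom i) y -> id y = transition i i y.
  by move=> [q [iq _] <-]; rewrite (transition_map i iq).
apply: etrans (diff_eq_on v (atlas_overlap SA i i) E (chart_image_map ip ip) di) _.
by rewrite ei.
Qed.

Lemma to_chart_trans i j p v : chart_dom i p -> chart_dom j p ->
  'd (transition i j) (chart_map i p) (to_chart i p v) = to_chart j p v.
Proof. exact: diff_transition_trans (atlas_at SA p). Qed.

Lemma to_chart_of i j p w : chart_dom i p -> chart_dom j p ->
  to_chart j p (of_chart i p w) = 'd (transition i j) (chart_map i p) w.
Proof. by move=> ip; apply: diff_transition_trans (atlas_at SA p). Qed.

Lemma of_chartK i p w : chart_dom i p -> to_chart i p (of_chart i p w) = w.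
Proof.
by move=> ip; apply: etrans (to_chart_of w ip ip) (diff_transition_id w ip).
Qed.

Lemma to_chartK i p v : chart_dom i p -> of_chart i p (to_chart i p v) = v.
Proof.
move=> ip; have ap := atlas_at SA p.
exact: etrans (diff_transition_trans v ap ip ap) (diff_transition_id v ap).
Qed.

Lemma to_chart_at p v : to_chart (chart_at A p) p v = v.
Proof. exact: diff_transition_id (atlas_at SA p). Qed.

Lemma of_chart_at p v : of_chart (chart_at A p) p v = v.
Proof. exact: diff_transition_id (atlas_at SA p). Qed.

Lemma linear_to_chart i p : linear (to_chart i p).
Proof. exact: linear_differential. Qed.

Lemma linear_of_chart i p : linear (of_chart i p).
Proof. exact: linear_differential. Qed.

Lemma vfield_coord_map i (X : vfield R m M) p : chart_dom i p ->
  vfield_coord i X (chart_map i p) = to_chart i p (X p).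
Proof. by move=> ip; rewrite /vfield_coord (atlas_mapK SA). Qed.

Lemma smooth_transition i j U : mopen A U -> U `<=` chart_dom j ->
  smooth_on (chart_image i U) (transition i j).
Proof.
move=> oU Uj; apply: smooth_onW (atlas_transition SA i j).
exact: chart_imageS.
Qed.

(** As one chart covers [U], the expression of [f] in any other chart is the given one after a
    smooth transition map. *)
Lemma smooth_from_chart (W : normedModType R) i U (f : M -> W) : mopen A U -> U `<=` chart_dom i ->
  smooth_on (chart_image i U) (f \o chart_inv i) ->
  forall j, smooth_on (chart_image j U) (f \o chart_inv j).
Proof.
move=> oU Ui Cf j.
apply: (@smooth_on_eq _ _ _ _ ((f \o chart_inv i) \o transition j i)) => //.
  move=> _ [p [jp Up] <-].
  by rewrite /= transition_map // !(atlas_mapK SA) //; apply: Ui.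
apply: smooth_on_comp Cf => //; last exact: smooth_transition.
move=> _ [p [jp Up] <-]; rewrite (transition_map i jp).
by apply: chart_image_map => //; apply: Ui.
Qed.

(** In a chart [j] the components are the differential of the transition from [i] to [j] applied to
    [w], taken at the [i]-coordinates of the point. *)
Lemma smooth_coord_vfield i w : smooth_vfield A (chart_dom i) (coord_vfield i w).
Proof.
move=> j; apply: (@smooth_on_eq _ _ _ _
  ((fun x => 'd (transition i j) x w) \o transition j i)).
- exact: atlas_overlap.
- move=> _ [p [jp ip] <-].
  by rewrite /= transition_map // vfield_coord_map // to_chart_of.
apply: (@smooth_on_comp _ _ _ _ _ (chart_image i (chart_dom j))).
- exact: atlas_overlap.
- by move=> _ [p [jp ip] <-]; rewrite transition_map //; apply: chart_image_map.
- exact: atlas_transition.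
- by apply: smooth_on_diff; [apply: atlas_overlap|apply: atlas_transition].
Qed.

Lemma smooth_vfieldW U V (X : vfield R m M) : V `<=` U ->
  smooth_vfield A U X -> smooth_vfield A V X.
Proof. by move=> VU CX i; apply: smooth_onW (CX i); apply: chart_imageS. Qed.

Lemma smooth_vfield_add U (X Y : vfield R m M) : mopen A U ->
  smooth_vfield A U X -> smooth_vfield A U Y ->
  smooth_vfield A U (fun p => X p + Y p).
Proof.
move=> oU CX CY i; apply: smooth_on_eq (smooth_on_add (oU i) (CX i) (CY i)) => //.
by move=> x _; rewrite /vfield_coord /to_chart linearD.
Qed.

Lemma smooth_vfield_scale U (f : M -> R^o) (X : vfield R m M) : mopen A U ->
  smooth_fun A U f -> smooth_vfield A U X ->
  smooth_vfield A U (fun p => f p *: X p).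
Proof.
move=> oU Cf CX i; apply: smooth_on_eq (smooth_on_scale (oU i) (Cf i) (CX i)) => //.
by move=> x _; rewrite /vfield_coord /to_chart linearZ.
Qed.

Lemma smooth_vfield0 U : mopen A U -> smooth_vfield A U (fun=> 0).
Proof.
move=> oU i; apply: smooth_on_eq (@smooth_on_cst _ _ _ _ 0) => //.
by move=> x _; rewrite /vfield_coord /to_chart linear0.
Qed.

Lemma smooth_vfield_sum U (I : Type) (r : seq I) (f : I -> M -> R^o)
    (X : I -> vfield R m M) : mopen A U ->
  (forall a, smooth_fun A U (f a)) -> (forall a, smooth_vfield A U (X a)) ->
  smooth_vfield A U (fun p => \sum_(a <- r) f a p *: X a p).
Proof.
move=> oU Cf CX i.
apply: (@smooth_on_eq _ _ _ _ (fun x => \sum_(a <- r)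
   (f a (chart_inv i x) : R^o) *: vfield_coord i (X a) x)) => //.
  move=> x _; rewrite [RHS]/vfield_coord linear_expand //; exact: linear_to_chart.
apply: smooth_on_sum => // a; apply: smooth_on_scale => //; [exact: Cf|exact: CX].
Qed.

Lemma smooth_vfield_coord U i (X : vfield R m M) a : mopen A U ->
  U `<=` chart_dom i -> smooth_vfield A U X ->
  smooth_fun A U (fun p => to_chart i p (X p) 0 a).
Proof.
move=> oU Ui CX; apply: (smooth_from_chart (i := i)) => //.
exact: smooth_on_coord (oU i) (CX i).
Qed.

Lemma vfield_expand i (X : vfield R m M) p : chart_dom i p ->
  X p = \sum_a to_chart i p (X p) 0 a *: coord_vfield i (delta_mx 0 a) p.
Proof.
move=> ip; rewrite -[LHS](to_chartK _ ip) linear_row_expand //.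
exact: linear_of_chart.
Qed.

End Charts.

Arguments atlas_overlap [R m M A] s i j.
Arguments atlas_transition [R m M A] s i j.
Arguments mopen_dom [R m M A] SA i _.
Arguments open_chart_image [R m M A] SA i.

(** * Hausdorff and second countability criteria in terms of charts *)

Section Separation.
Context {R : realType}.

(** Balls with rational centre and radius [1 / (n + 1)], enumerated by [pickle]; a number coding no
    ball gets the empty set. A radius below [e / 2] keeps a ball through [x] inside the [e]-ball
    around [x]. *)
Lemma rV_countable_basis m : exists Q : nat -> set 'rV[R]_m,
  (forall k, open (Q k)) /\
  (forall O x, open O -> O x -> exists k, Q k x /\ Q k `<=` O).
Proof.
pose q (c : 'rV[rat]_m * nat) := ball (map_mx ratr c.1 : 'rV[R]_m) (c.2.+1%:R^-1).
exists (fun k => if unpickle k is Some c then q c else set0); split=> [k|O x oO Ox].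
  by case: unpickle => [c|]; [apply: ball_open|apply: open0].
have /nbhs_ballP[e /= e0 eO] : nbhs x O by apply: open_nbhs_nbhs.
have [n ne] : exists n : nat, (n.+1%:R^-1 : R) < e / 2.
  have e20 : 0 < e / 2 by apply: divr_gt0.
  have := near_infty_natSinv_lt (PosNum e20) => -[N _ /(_ N (leqnn N))] /= ?.
  by exists N.
have [r xr] : exists r : 'rV[rat]_m, ball (map_mx ratr r : 'rV[R]_m) (n.+1%:R^-1) x.
  (* Balls of rows are defined entrywise, so a rational centre can be chosen one coordinate at a
     time. *)
  have /choice[r rP] : forall j, exists r : rat, ball (ratr r : R) (n.+1%:R^-1) (x 0 j).
    move=> j; have [|r] := @rat_in_itvoo R (x 0 j - n.+1%:R^-1) (x 0 j + n.+1%:R^-1).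
      by rewrite ltrD2l gtrN // invr_gt0.
    rewrite in_itv /= => /andP[r1 r2]; exists r.
    by rewrite /ball /= ltr_distl r1 r2.
  exists (\row_j r j); split; first by rewrite invr_gt0.
  by move=> i j; rewrite !mxE ord1.
exists (pickle (r, n)); rewrite pickleK; split => // y yr.
apply: eO; rewrite [e]splitr; apply: (@ball_triangle _ _ (map_mx ratr r : 'rV[R]_m)).
  by apply: ball_sym; apply: le_ball xr; apply: ltW.
by apply: le_ball yr; apply: ltW.
Qed.

Context {m : nat} {M : Type} (A : atlas R m M).
Implicit Types (i j : chart_index A) (p q : M) (U V : set M).
Hypothesis SA : smooth_atlas A.

Lemma mopen_chart_preimage i (O : set 'rV[R]_m) : open O ->
  mopen A [set p | chart_dom i p /\ O (chart_map i p)].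
Proof.
move=> oO j.
suff -> : chart_image j [set p | chart_dom i p /\ O (chart_map i p)] =
    chart_image j (chart_dom i) `&` transition j i @^-1` O.
  exact: open_preimage_on (atlas_overlap SA j i) oO
    (smooth_on_continuous (atlas_transition SA j i)).
apply/seteqP; split=> x.
  move=> [p [jp [ip Op]] <-]; split; first exact: chart_image_map.
  by rewrite /preimage /= (transition_map SA i jp).
move=> [[p [jp ip] <-]]; rewrite /preimage /= (transition_map SA i jp) => Op.
exact: chart_image_map.
Qed.

Lemma chart_separation i p q : chart_dom i p -> chart_dom i q -> p <> q ->
  exists U V, [/\ mopen A U, mopen A V, U p, V q & U `&` V = set0].
Proof.
move=> ip iq pq.
have ne : chart_map i p != chart_map i q.
  by apply/eqP => /(congr1 (chart_inv i)); rewrite !(atlas_mapK SA).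
have := @norm_hausdorff _ 'rV[R]_m; rewrite open_hausdorff.
move=> /(_ _ _ ne)[[B C] /= [pB qC] [oB oC /eqP BC]].
rewrite !inE in pB qC.
exists [set r | chart_dom i r /\ B (chart_map i r)].
exists [set r | chart_dom i r /\ C (chart_map i r)].
split => //; try exact: mopen_chart_preimage.
rewrite -subset0 => r [[_ Br] [_ Cr]].
by have : (B `&` C) (chart_map i r) by []; rewrite BC.
Qed.

(** The countable basis of the model space is pulled back along each of the countably many charts.
    The option type lets some numbers name no chart, as needed when [M] is empty. *)
Lemma second_countable_of_cover (c : nat -> option (chart_index A)) :
  (forall p, exists k i, c k = Some i /\ chart_dom i p) ->
  exists B : nat -> set M, (forall k, mopen A (B k)) /\
    (forall U p, mopen A U -> U p -> exists k, B k p /\ B k `<=` U).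
Proof.
move=> cP; have [Q [oQ QP]] := rV_countable_basis m.
pose b (a : nat * nat) := if c a.1 is Some i then
  [set p | chart_dom i p /\ Q a.2 (chart_map i p)] else set0.
have mopen0 : mopen A set0.
  move=> i; rewrite (_ : chart_image i set0 = set0); first exact: open0.
  by rewrite -subset0 => x [p []].
exists (fun k => if unpickle k is Some a then b a else set0); split=> [k|U p oU Up].
  case: unpickle => [a|] //; rewrite /b; case: (c a.1) => [i|] //.
  exact: mopen_chart_preimage.
have [k [i [ck ip]]] := cP p.
have [l [Ql QU]] := QP _ _ (oU i) (chart_image_map ip Up).
exists (pickle (k, l)); rewrite pickleK /b ck /=; split=> // q [iq].
by move=> /QU/(chart_image_inv SA)[_]; rewrite (atlas_mapK SA iq).
Qed.

End Separation.

Lemma smooth_manifold_atlas (R : realType) m M (A : atlas R m M) :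
  smooth_manifold A -> smooth_atlas A.
Proof. by case=> *; split. Qed.

(** A Lindelof argument: for each basic open set contained in some chart domain, choose one such
    chart. Every point lies in a basic set inside the domain of its preferred chart. *)
Lemma countable_chart_cover (R : realType) m M (A : atlas R m M) :
  smooth_manifold A -> exists c : nat -> option (chart_index A),
    forall p, exists k i, c k = Some i /\ chart_dom i p.
Proof.
move=> SM; have SA := smooth_manifold_atlas SM.
have [B [oB BP]] := manifold_second_countable SM.
have H : forall k : nat, exists o : option (chart_index A),
    forall i : chart_index A, B k `<=` chart_dom i -> exists2 j, o = Some j & B k `<=` chart_dom j.
  move=> k; have [[i ki]|nk] := pselect (exists i : chart_index A, B k `<=` chart_dom i).
    by exists (Some i) => j _; exists i.
  by exists None => i ki; case: nk; exists i.
have [c cP] := boolp.choice H.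
exists c => p; have [k [Bp Bk]] := BP _ _ (mopen_dom SA (chart_at A p)) (atlas_at SA p).
by have [j cj kj] := cP _ _ Bk; exists k, j; split=> //; apply: kj.
Qed.

(** * Differentials of families of linear maps and of block rows *)

Section DiffFamily.
Context {R : realType}.
Implicit Types V W : normedModType R.

Lemma diff_sum V W (I : Type) (r : seq I) (f : I -> V -> W) x v :
  (forall i, differentiable (f i) x) ->
  differentiable (fun y => \sum_(i <- r) f i y) x /\
  'd (fun y => \sum_(i <- r) f i y) x v = \sum_(i <- r) 'd (f i) x v.
Proof.
move=> df; elim: r => [|i r [dr Er]].
  have -> : (fun y => \sum_(i <- [::]) f i y) = cst 0.
    by apply/funext => y; rewrite big_nil.
  by split; [exact: differentiable_cst | rewrite diff_cst big_nil].
have -> : (fun y => \sum_(j <- i :: r) f j y) = f i + (fun y => \sum_(i <- r) f i y).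
  by apply/funext => y; rewrite big_cons.
split; first exact: differentiableD.
by rewrite (diffD (df i) dr) big_cons -Er.
Qed.

Lemma diff_coord V n (w : V -> 'rV[R]_n) x v j : differentiable w x ->
  differentiable (fun y => w y 0 j : R^o) x /\
  'd (fun y => w y 0 j : R^o) x v = ('d w x v) 0 j.
Proof.
move=> dw.
have lc : linear (fun u : 'rV[R]_n => u 0 j : R^o) by move=> a u u'; rewrite !mxE.
pose L : {linear 'rV[R]_n -> R^o} := HB.pack (fun u : 'rV[R]_n => u 0 j : R^o)
  (GRing.isLinear.Build _ _ _ _ _ lc).
have cL : continuous L by apply: coord_continuous.
have dL : differentiable L (w x) by exact: linear_differentiable.
split; first exact: (differentiable_comp dw dL).
apply: etrans (congr1 (fun h => h v) (diff_comp dw dL)) _ => /=.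
by rewrite (diff_lin _ cL).
Qed.

(** A product rule in which [F] is differentiated with its vector argument frozen. For [F] the
    differential of a transition map, the last term is a second derivative. *)
Lemma diff_family V W n (D : set V) (F : V -> 'rV[R]_n -> W)
    (w : V -> 'rV[R]_n) x v : open D -> D x ->
  (forall y, D y -> linear (F y)) ->
  (forall u, differentiable (fun y => F y u) x) -> differentiable w x ->
  differentiable (fun y => F y (w y)) x /\
  'd (fun y => F y (w y)) x v = F x ('d w x v) + 'd (fun y => F y (w x)) x v.
Proof.
move=> oD Dx lF dF.
have step (w' : V -> 'rV[R]_n) : differentiable w' x ->
    differentiable (fun y => F y (w' y)) x /\
    'd (fun y => F y (w' y)) x v = F x ('d w' x v) +
      \sum_j w' x 0 j *: 'd (fun y => F y (delta_mx 0 j)) x v.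
  move=> dw.
  have dj j := diff_scale (diff_coord v j dw).1 (dF (delta_mx 0 j)).
  have [dS ES] := diff_sum (index_enum _) v (fun j => (dj j).1).
  have E y : D y -> \sum_j (w' y 0 j : R^o) *: F y (delta_mx 0 j) = F y (w' y).
    by move=> Dy; rewrite -linear_row_expand //; apply: lF.
  have nE := near_of_open oD Dx E.
  have [dG EG] := near_eq_differentiable nE dS.
  split=> //; apply: etrans (congr1 (fun h => h v) EG) _; apply: etrans ES _.
  rewrite (linear_row_expand ('d w' x v) (lF x Dx)) -big_split /=.
  apply: eq_bigr => j _; rewrite ((dj j).2 v) addrC.
  by congr (_ *: _ + _); rewrite (diff_coord v j dw).2.
move=> dw; have [dG EG] := step w dw; split=> //; apply: etrans EG _; congr (_ + _).
have [_ EC] := step (cst (w x)) (differentiable_cst _ _).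
by apply/esym; apply: etrans EC _; rewrite diff_cst (linear_zero (lF x Dx)) add0r.
Qed.

Lemma diff_linear_row V W n (L : 'rV[R]_n -> W) (w : V -> 'rV[R]_n) x v :
  linear L -> differentiable w x ->
  differentiable (fun y => L (w y)) x /\
  'd (fun y => L (w y)) x v = L ('d w x v).
Proof.
move=> lL dw.
have [d E] := diff_family (D := setT) (F := fun=> L) v openT I (fun _ _ => lL)
  (fun u => differentiable_cst _ _) dw.
by split=> //; apply: etrans E _; rewrite diff_cst addr0.
Qed.

Lemma linear_row_mxl m n : linear (fun a : 'rV[R]_m => row_mx a (0 : 'rV[R]_n)).
Proof. by move=> c a b; rewrite scale_row_mx add_row_mx scaler0 addr0. Qed.

Lemma linear_row_mxr m n : linear (fun a : 'rV[R]_n => row_mx (0 : 'rV[R]_m) a).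
Proof. by move=> c a b; rewrite scale_row_mx add_row_mx scaler0 addr0. Qed.

Lemma row_mx_split m n (a : 'rV[R]_m) (b : 'rV[R]_n) :
  row_mx a b = row_mx a 0 + row_mx 0 b.
Proof. by rewrite add_row_mx addr0 add0r. Qed.

Lemma smooth_on_row_mx V m n (D : set V) (a : V -> 'rV[R]_m) (b : V -> 'rV[R]_n) :
  open D -> smooth_on D a -> smooth_on D b ->
  smooth_on D (fun x => row_mx (a x) (b x)).
Proof.
move=> oD Ca Cb; apply: smooth_on_eq (smooth_on_add oD
  (smooth_on_linear oD (@linear_row_mxl m n) Ca)
  (smooth_on_linear oD (@linear_row_mxr m n) Cb)) => //.
by move=> x _; rewrite -row_mx_split.
Qed.

Lemma diff_row_mx V m n (a : V -> 'rV[R]_m) (b : V -> 'rV[R]_n) x v :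
  differentiable a x -> differentiable b x ->
  differentiable (fun x => row_mx (a x) (b x)) x /\
  'd (fun x => row_mx (a x) (b x)) x v = row_mx ('d a x v) ('d b x v).
Proof.
move=> da db.
have [da' Ea] := diff_linear_row v (@linear_row_mxl m n) da.
have [db' Eb] := diff_linear_row v (@linear_row_mxr m n) db.
have -> : (fun x => row_mx (a x) (b x)) =
   (fun x => row_mx (a x) 0) + (fun x => row_mx 0 (b x)).
  by apply/funext => y; rewrite [LHS]row_mx_split.
split; first exact: differentiableD.
by rewrite (diffD da' db') [RHS]row_mx_split -Ea -Eb.
Qed.

Lemma diff_lsubmx m n (z v : 'rV[R]_(m + n)) :
  'd (lsubmx : 'rV[R]_(m + n) -> 'rV[R]_m) z v = lsubmx v.
Proof. by rewrite diff_lin //; exact: continuous_lsubmx. Qed.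

Lemma diff_rsubmx m n (z v : 'rV[R]_(m + n)) :
  'd (rsubmx : 'rV[R]_(m + n) -> 'rV[R]_n) z v = rsubmx v.
Proof. by rewrite diff_lin //; exact: continuous_rsubmx. Qed.

Lemma smooth_on_lsubmx m n (D : set 'rV[R]_(m + n)) : open D ->
  smooth_on D (lsubmx : 'rV[R]_(m + n) -> 'rV[R]_m).
Proof.
move=> oD; apply: (smooth_on_linear (L := lsubmx) oD _ (@smooth_on_id _ _ D)).
exact: linearP.
Qed.

Lemma smooth_on_rsubmx m n (D : set 'rV[R]_(m + n)) : open D ->
  smooth_on D (rsubmx : 'rV[R]_(m + n) -> 'rV[R]_n).
Proof.
move=> oD; apply: (smooth_on_linear (L := rsubmx) oD _ (@smooth_on_id _ _ D)).
exact: linearP.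
Qed.

End DiffFamily.

(** * The atlas of the tangent bundle *)

Section TangentAtlas.
Context {R : realType} {m : nat} {M : Type} (A : atlas R m M).
Implicit Types (i j : chart_index A) (p q : M) (U V : set M).
Hypothesis SA : smooth_atlas A.
Let TA := tbundle_atlas A.

Lemma tbundle_chart_image i U :
  @chart_image _ _ _ TA i [set u | U u.1] = [set z | chart_image i U (lsubmx z)].
Proof.
apply/seteqP; split=> z.
  by move=> [u [iu Uu] <-] /=; rewrite row_mxKl; apply: chart_image_map.
move=> [p [ip Up] /= E]; exists (p, of_chart i p (rsubmx z)) => //=.
by rewrite of_chartK // E hsubmxK.
Qed.

Lemma open_tbundle_image i U : open (chart_image i U) ->
  open [set z : 'rV[R]_(m + m) | chart_image i U (lsubmx z)].
Proof.
move=> oU; apply: open_comp oU => z _; exact: continuous_lsubmx.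
Qed.

Lemma tbundle_transition i j (z : 'rV[R]_(m + m)) :
  chart_image i (chart_dom j) (lsubmx z) ->
  @transition _ _ _ TA i j z = row_mx (transition i j (lsubmx z))
    ('d (transition i j) (lsubmx z) (rsubmx z)).
Proof.
move=> /(chart_image_inv SA)[ip jp E]; rewrite /transition /=.
by rewrite (to_chart_of SA _ ip jp) E.
Qed.

Lemma smooth_tbundle_diff i j (D := chart_image i (chart_dom j)) :
  smooth_on [set z : 'rV[R]_(m + m) | D (lsubmx z)]
    (fun z => 'd (transition i j) (lsubmx z) (rsubmx z)).
Proof.
have oD : open [set z : 'rV[R]_(m + m) | D (lsubmx z)].
  exact: open_tbundle_image (atlas_overlap SA i j).
apply: (smooth_on_family (F := fun z => 'd (transition i j) (lsubmx z))) => //.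
- by move=> z _; exact: linear_differential.
- move=> v; apply: (smooth_on_comp (E := D) (f := fun x => 'd (transition i j) x v)) => //.
    exact: smooth_on_lsubmx.
  exact: smooth_on_diff (atlas_overlap SA i j) (atlas_transition SA i j).
- exact: smooth_on_rsubmx.
Qed.

Lemma smooth_tbundle_atlas : smooth_atlas TA.
Proof.
have oT i j : open [set z : 'rV[R]_(m + m) | chart_image i (chart_dom j) (lsubmx z)].
  exact: open_tbundle_image (atlas_overlap SA i j).
have sT i j : smooth_on [set z : 'rV[R]_(m + m) | chart_image i (chart_dom j) (lsubmx z)]
    (@transition _ _ _ TA i j).
  apply: (@smooth_on_eq _ _ _ _ (fun z => row_mx (transition i j (lsubmx z))
      ('d (transition i j) (lsubmx z) (rsubmx z)))) => //.
    by move=> z /tbundle_transition.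
  apply: smooth_on_row_mx => //; last exact: smooth_tbundle_diff.
  apply: (smooth_on_comp (E := chart_image i (chart_dom j))) => //.
    exact: smooth_on_lsubmx.
  exact: atlas_transition.
split.
- by move=> u; exact: atlas_at SA u.1.
- by move=> i [p v] /= ip; rewrite row_mxKl row_mxKr (atlas_mapK SA ip) to_chartK.
- by move=> i j; rewrite (tbundle_chart_image i (@chart_dom _ _ _ A j)); exact: oT.
by move=> i j; rewrite (tbundle_chart_image i (@chart_dom _ _ _ A j)); exact: sT.
Qed.

Lemma mopen_tbundle U : mopen A U -> mopen TA [set u | U u.1].
Proof. by move=> oU i; rewrite tbundle_chart_image; exact: open_tbundle_image. Qed.

(* The transition map of the tangent bundle is (x, y) |-> (t x, dt_x y); the
   second derivative of t appears in its differential. *)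
Lemma tbundle_to_chart i p y a b (c := chart_at A p) : chart_dom i p ->
  @to_chart _ _ _ TA i (p, y) (row_mx a b) = row_mx (to_chart i p a)
    (to_chart i p b + 'd (fun x => 'd (transition c i) x y) (chart_map c p) a).
Proof.
move=> ip; have cp : chart_dom c p := atlas_at SA p.
set x := chart_map c p; set D := chart_image c (chart_dom i).
have oD : open D := atlas_overlap SA c i.
have Dx : D x by exact: chart_image_map.
pose z : 'rV[R]_(m + m) := row_mx x y.
have zl : lsubmx z = x by rewrite row_mxKl.
have zr : rsubmx z = y by rewrite row_mxKr.
(* In the preferred chart the components of [y] are [y] itself, so the differential is taken at
   [z]. *)
rewrite /to_chart /= -/c -/x -[X in row_mx x X]/(to_chart c p y) to_chart_at // -/z.
have dl : differentiable (lsubmx : 'rV[R]_(m + m) -> 'rV[R]_m) z.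
  exact: differentiable_lsubmx.
have dr : differentiable (rsubmx : 'rV[R]_(m + m) -> 'rV[R]_m) z.
  exact: differentiable_rsubmx.
have dt : differentiable (transition c i) (lsubmx z).
  by rewrite zl; exact: transition_differentiable.
have d2 w : differentiable (fun x => 'd (transition c i) x w) (lsubmx z).
  rewrite zl; apply: smooth_on_differentiable Dx.
  exact: smooth_on_diff (atlas_transition SA c i).
have oDz := open_tbundle_image oD.
have Dz : D (lsubmx z) by rewrite zl.
set v := row_mx a b.
have [dF EF] := diff_family (F := fun z => 'd (transition c i) (lsubmx z)) v oDz Dz
  (fun z _ => linear_differential (transition c i) (lsubmx z))
  (fun w => differentiable_comp dl (d2 w)) dr.
have dtl := differentiable_comp dl dt.
have [dT ET] := diff_row_mx v dtl dF.
have E w : [set z : 'rV[R]_(m + m) | D (lsubmx z)] w ->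
    row_mx (transition c i (lsubmx w)) ('d (transition c i) (lsubmx w) (rsubmx w)) =
    @transition _ _ _ TA c i w.
  by move=> /tbundle_transition ->.
apply: etrans (diff_eq_on v oDz E Dz dT) _; apply: etrans ET _.
congr row_mx.
  apply: etrans (congr1 (fun h => h v) (diff_comp dl dt)) _.
  by rewrite /= diff_lsubmx zl row_mxKl.
apply: etrans EF _; congr (_ + _).
  by rewrite diff_rsubmx zl row_mxKr.
rewrite zr.
apply: etrans (congr1 (fun h => h v) (diff_comp dl (d2 y))) _.
by rewrite /= diff_lsubmx zl row_mxKl.
Qed.

End TangentAtlas.

(** Two vectors over the same point lie in one induced chart and are separated there; over distinct
    points, the preimages of separating open sets of [M] do it. A countable family of charts
    covering [M] induces one covering the bundle. *)
Lemma tbundle_manifold (R : realType) m M (A : atlas R m M) :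
  smooth_manifold A -> smooth_manifold (tbundle_atlas A).
Proof.
move=> SM; have SA := smooth_manifold_atlas SM; have STA := smooth_tbundle_atlas SA.
split.
- exact: atlas_at STA.
- exact: atlas_mapK STA.
- exact: atlas_overlap STA.
- exact: atlas_transition STA.
- move=> [p v] [q w] ne; have [pq|pq] := pselect (p = q).
    subst q; apply: (chart_separation STA (i := chart_at A p)) => //.
      exact: atlas_at SA p.
    exact: atlas_at SA p.
  have [U [V [oU oV Up Vq UV]]] := manifold_hausdorff SM pq.
  exists [set u | U u.1], [set u | V u.1]; split=> //; try exact: mopen_tbundle.
  rewrite -subset0 => u [Uu Vu].
  by have : (U `&` V) u.1 by []; rewrite UV.
have [c cP] := countable_chart_cover SM.
apply: (second_countable_of_cover STA (c := c)) => u.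
exact: cP.
Qed.

(** * Locality and local expression of a linear connection *)

Section Connection.
Context {R : realType} {m : nat} {M : Type} (A : atlas R m M).
Implicit Types (i j : chart_index A) (p q : M) (U V : set M).
Hypothesis SA : smooth_atlas A.
Variable nabla : vfield R m M -> vfield R m M -> vfield R m M.
Hypothesis LC : linear_connection A nabla.
Implicit Types X Y : vfield R m M.

Lemma smooth_fun_cst U (c : R) : mopen A U -> smooth_fun A U (fun=> c).
Proof. by move=> oU i; exact: smooth_on_cst. Qed.

Lemma smooth_vfield_sub U X Y : mopen A U ->
  smooth_vfield A U X -> smooth_vfield A U Y ->
  smooth_vfield A U (fun q => X q - Y q).
Proof.
move=> oU CX CY.
have -> : (fun q => X q - Y q) = (fun q => X q + (-1 : R) *: Y q).
  by apply/funext => q; rewrite scaleN1r.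
apply: smooth_vfield_add => //; apply: (smooth_vfield_scale (f := fun=> -1)) => //.
exact: smooth_fun_cst.
Qed.

(* As vector fields are total functions, locality follows by scaling with the
   function that is 0 on U and 1 outside: it is smooth on U. *)
Let off U q : R^o := if `[< U q >] then 0 else 1.

Let off_in U q : U q -> off U q = 0.
Proof. by move=> Uq; rewrite /off asboolT. Qed.

Let smooth_off U : mopen A U -> smooth_fun A U (off U).
Proof.
move=> oU i; apply: smooth_on_eq (@smooth_on_cst _ _ _ _ 0) => //.
by move=> _ [q [iq Uq] <-]; rewrite /= (atlas_mapK SA iq) off_in.
Qed.

Let off_split U (X X' : vfield R m M) : (forall q, U q -> X q = X' q) ->
  X' = (fun q => off U q *: (X' q - X q) + X q).
Proof.
move=> XX'; apply/funext => q; rewrite /off; case: asboolP => [Uq|_].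
  by rewrite scale0r add0r XX'.
by rewrite scale1r subrK.
Qed.

Lemma nabla_local_l U X X' Y p : mopen A U ->
  smooth_vfield A U X -> smooth_vfield A U X' -> smooth_vfield A U Y ->
  (forall q, U q -> X q = X' q) -> U p -> nabla X Y p = nabla X' Y p.
Proof.
move=> oU CX CX' CY XX' Up; rewrite (off_split XX').
rewrite (nabla_linl LC oU (smooth_off oU) (smooth_vfield_sub oU CX' CX) CX CY Up).
by rewrite off_in // scale0r add0r.
Qed.

(** In the Leibniz rule for [off U] times [Y' - Y], one term vanishes because [Y' p = Y p] and the
    other because [off U p = 0]; the derivative of [off U] need not be computed. *)
Lemma nabla_local_r U X Y Y' p : mopen A U ->
  smooth_vfield A U X -> smooth_vfield A U Y -> smooth_vfield A U Y' ->
  (forall q, U q -> Y q = Y' q) -> U p -> nabla X Y p = nabla X Y' p.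
Proof.
move=> oU CX CY CY' YY' Up; rewrite (off_split YY').
have CD := smooth_vfield_sub oU CY' CY; have Cf := smooth_off oU.
rewrite (nabla_addr LC oU CX (smooth_vfield_scale oU Cf CD) CY Up).
rewrite (nabla_leibniz LC oU Cf CX CD Up).
by rewrite off_in // YY' // subrr scaler0 scale0r !add0r.
Qed.

Lemma nabla0l U Y p : mopen A U -> smooth_vfield A U Y -> U p ->
  nabla (fun=> 0) Y p = 0.
Proof.
move=> oU CY Up; have C0 := smooth_vfield0 oU.
have := nabla_linl LC oU (smooth_fun_cst 1 oU) C0 C0 CY Up.
have -> : (fun q : M => (1 : R) *: (0 : 'rV[R]_m) + 0) = (fun=> 0).
  by apply/funext => q; rewrite scaler0 addr0.
by rewrite scale1r => /eqP; rewrite -subr_eq0 opprD addrA subrr add0r oppr_eq0 => /eqP.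
Qed.

Lemma nabla0r U X p : mopen A U -> smooth_vfield A U X -> U p ->
  nabla X (fun=> 0) p = 0.
Proof.
move=> oU CX Up; have C0 := smooth_vfield0 oU.
have := nabla_addr LC oU CX C0 C0 Up.
have -> : (fun q : M => (0 : 'rV[R]_m) + 0) = (fun=> 0).
  by apply/funext => q; rewrite addr0.
by move=> /eqP; rewrite -subr_eq0 opprD addrA subrr add0r oppr_eq0 => /eqP.
Qed.

Lemma nabla_sum_l U (I : Type) (r : seq I) (f : I -> M -> R^o)
    (X : I -> vfield R m M) Y p : mopen A U ->
  (forall a, smooth_fun A U (f a)) -> (forall a, smooth_vfield A U (X a)) ->
  smooth_vfield A U Y -> U p ->
  nabla (fun q => \sum_(a <- r) f a q *: X a q) Y p =
  \sum_(a <- r) f a p *: nabla (X a) Y p.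
Proof.
move=> oU Cf CX CY Up; elim: r => [|a r IHr].
  rewrite big_nil; apply: etrans (nabla0l oU CY Up); congr (nabla _ _ _).
  by apply/funext => q; rewrite big_nil.
rewrite big_cons -IHr.
rewrite -(nabla_linl LC oU (Cf a) (CX a) (smooth_vfield_sum r oU Cf CX) CY Up).
by congr (nabla _ _ _); apply/funext => q; rewrite big_cons.
Qed.

Lemma nabla_sum_r U (I : Type) (r : seq I) (f : I -> M -> R^o) X
    (Y : I -> vfield R m M) p : mopen A U ->
  (forall a, smooth_fun A U (f a)) -> (forall a, smooth_vfield A U (Y a)) ->
  smooth_vfield A U X -> U p ->
  nabla X (fun q => \sum_(a <- r) f a q *: Y a q) p =
  \sum_(a <- r) (vfield_deriv A X (f a) p *: Y a p + f a p *: nabla X (Y a) p).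
Proof.
move=> oU Cf CY CX Up; elim: r => [|a r IHr].
  rewrite big_nil; apply: etrans (nabla0r oU CX Up); congr (nabla _ _ _).
  by apply/funext => q; rewrite big_nil.
rewrite big_cons -IHr -(nabla_leibniz LC oU (Cf a) CX (CY a) Up).
rewrite -(nabla_addr LC oU CX (smooth_vfield_scale oU (Cf a) (CY a))
  (smooth_vfield_sum r oU Cf CY) Up).
by congr (nabla _ _ _); apply/funext => q; rewrite big_cons.
Qed.

(** The expansion of [X] in coordinate fields is valid on the chart domain only, hence the passage
    to [V] and the use of locality. *)
Lemma nabla_expand i U X Y p : mopen A U -> smooth_vfield A U X ->
  smooth_vfield A U Y -> U p -> chart_dom i p ->
  nabla X Y p =
  \sum_a to_chart i p (X p) 0 a *: nabla (coord_vfield i (delta_mx 0 a)) Y p.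
Proof.
move=> oU CX CY Up ip; pose V := U `&` chart_dom i.
have oV : mopen A V := mopenI SA oU (mopen_dom SA i).
have Vi : V `<=` chart_dom i by move=> q [].
have VU : V `<=` U by move=> q [].
have Vp : V p by [].
have CXV := smooth_vfieldW VU CX; have CYV := smooth_vfieldW VU CY.
have Cf a := smooth_vfield_coord SA a oV Vi CXV.
have CE a := smooth_vfieldW Vi (smooth_coord_vfield SA i (delta_mx 0 a)).
rewrite -(nabla_sum_l (index_enum _) oV Cf CE CYV Vp).
apply: nabla_local_l oV CXV (smooth_vfield_sum _ oV Cf CE) CYV _ Vp.
by move=> q [_ iq]; exact: vfield_expand.
Qed.

(** The expansion in the coordinate fields of one chart involves [X] only through [X p]. *)
Lemma nabla_tensorial U X X' Y p : mopen A U -> smooth_vfield A U X ->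
  smooth_vfield A U X' -> smooth_vfield A U Y -> U p -> X p = X' p ->
  nabla X Y p = nabla X' Y p.
Proof.
move=> oU CX CX' CY Up E; have ap := atlas_at SA p.
by rewrite (nabla_expand oU CX CY Up ap) (nabla_expand oU CX' CY Up ap) E.
Qed.

(** The vector with components [Gamma_ab^c a^a b^b]. As a bilinear map, rather than an array of
    symbols, it fits the principle for smooth families of linear maps. *)
Definition christoffel i p (a b : 'rV[R]_m) : 'rV[R]_m :=
  to_chart i p (nabla (coord_vfield i a) (coord_vfield i b) p).

Lemma christoffel_linear_l i p b : chart_dom i p ->
  linear (fun a => christoffel i p a b).
Proof.
move=> ip c a a'; have oU := mopen_dom SA i; have CE := smooth_coord_vfield SA i.
rewrite /christoffel -linear_to_chart.
rewrite -(nabla_linl LC oU (smooth_fun_cst c oU) (CE a) (CE a') (CE b) ip).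
congr (to_chart i p (nabla _ _ _)); apply/funext => q.
by rewrite /coord_vfield linear_of_chart.
Qed.

Lemma christoffel_linear_r i p a : chart_dom i p ->
  linear (christoffel i p a).
Proof.
move=> ip c b b'; have oU := mopen_dom SA i; have CE := smooth_coord_vfield SA i.
have Cc := smooth_fun_cst c oU.
rewrite /christoffel -linear_to_chart; congr (to_chart i p _).
have -> : coord_vfield i (c *: b + b') =
    (fun q => c *: coord_vfield i b q + coord_vfield i b' q).
  by apply/funext => q; rewrite /coord_vfield linear_of_chart.
rewrite (nabla_addr LC oU (CE a) (smooth_vfield_scale oU Cc (CE b)) (CE b') ip).
rewrite (nabla_leibniz LC oU Cc (CE a) (CE b) ip).
suff -> : vfield_deriv A (coord_vfield i a) (fun=> c) p = 0 by rewrite scale0r add0r.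
by rewrite /vfield_deriv (_ : _ \o _ = cst c) // diff_cst.
Qed.

Lemma smooth_christoffel i a b :
  smooth_on (chart_image i setT) (fun x => christoffel i (chart_inv i x) a b).
Proof.
have CE := smooth_coord_vfield SA i.
rewrite chart_imageT.
exact: (nabla_smooth LC (mopen_dom SA i) (CE a) (CE b)).
Qed.

(** [vfield_deriv] differentiates in the preferred chart at [p]; the chain rule along the transition
    to [i] turns [X p] into its components in [i]. *)
Lemma vfield_deriv_coord i U X Y p a : mopen A U -> U `<=` chart_dom i ->
  smooth_vfield A U Y -> U p ->
  vfield_deriv A X (fun q => to_chart i q (Y q) 0 a) p =
  ('d (vfield_coord i Y) (chart_map i p) (to_chart i p (X p))) 0 a.
Proof.
move=> oU Ui CY Up; rewrite /vfield_deriv; set c := chart_at A p.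
have ip := Ui _ Up; have cp : chart_dom c p := atlas_at SA p.
have dY : differentiable (vfield_coord i Y) (transition c i (chart_map c p)).
  rewrite (transition_map SA i cp).
  by apply: smooth_on_differentiable (CY i) _ _; exact: chart_image_map.
have dt : differentiable (transition c i) (chart_map c p).
  exact: transition_differentiable.
have [dYa EYa] := diff_coord (to_chart i p (X p)) a dY.
have dc := differentiable_comp dt dYa.
have E y : chart_image c U y ->
   ((fun x => vfield_coord i Y x 0 a : R^o) \o transition c i) y =
   ((fun q => to_chart i q (Y q) 0 a : R^o) \o chart_inv c) y.
  move=> [q [cq Uq] <-] /=.
  by rewrite (transition_map SA i cq) (vfield_coord_map SA _ (Ui _ Uq)) (atlas_mapK SA cq).
apply: etrans (diff_eq_on (X p) (oU c) E (chart_image_map cp Up) dc) _.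
apply: etrans (congr1 (fun h => h (X p)) (diff_comp dt dYa)) _.
by apply: etrans EYa _; rewrite (transition_map SA i cp).
Qed.

(** The Leibniz rule applied to the expansion of [Y] in coordinate fields: derivatives of its
    components give the first term, derivatives of the coordinate fields the second. *)
Lemma nabla_chart i U X Y p : mopen A U -> smooth_vfield A U X ->
  smooth_vfield A U Y -> U p -> chart_dom i p ->
  to_chart i p (nabla X Y p) =
  'd (vfield_coord i Y) (chart_map i p) (to_chart i p (X p)) +
  christoffel i p (to_chart i p (X p)) (to_chart i p (Y p)).
Proof.
move=> oU CX CY Up ip; pose V := U `&` chart_dom i.
have oV : mopen A V := mopenI SA oU (mopen_dom SA i).
have Vi : V `<=` chart_dom i by move=> q [].
have VU : V `<=` U by move=> q [].
have Vp : V p by [].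
have CXV := smooth_vfieldW VU CX; have CYV := smooth_vfieldW VU CY.
have Cf a := smooth_vfield_coord SA a oV Vi CYV.
have CE w := smooth_vfieldW Vi (smooth_coord_vfield SA i w).
have -> : nabla X Y p = \sum_a
    (vfield_deriv A X (fun q => to_chart i q (Y q) 0 a) p *:
       coord_vfield i (delta_mx 0 a) p +
     to_chart i p (Y p) 0 a *: nabla X (coord_vfield i (delta_mx 0 a)) p).
  rewrite -(nabla_sum_r (index_enum _) oV Cf (fun a => CE _) CXV Vp).
  apply: nabla_local_r oV CXV CYV (smooth_vfield_sum _ oV Cf (fun a => CE _)) _ Vp.
  by move=> q [_ iq]; exact: vfield_expand.
(* By tensoriality [X] may be replaced by the coordinate field with the same value at [p], as in
   [christoffel]. *)
have XE : X p = coord_vfield i (to_chart i p (X p)) p by rewrite /coord_vfield to_chartK.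
have lT := linear_to_chart i p.
rewrite big_split /=; apply: etrans (linear_add lT _ _) _; congr (_ + _).
  apply: etrans (linear_expand _ _ _ lT) _; rewrite [RHS]row_sum_delta.
  apply: eq_bigr => a _.
  by rewrite (vfield_deriv_coord X a oV Vi CYV Vp) /coord_vfield of_chartK.
apply: etrans (linear_expand _ _ _ lT) _.
apply: etrans _ (esym (linear_row_expand _ (christoffel_linear_r _ ip))).
apply: eq_bigr => a _.
by rewrite (nabla_tensorial oV CXV (CE _) (CE _) Vp XE).
Qed.

(** The transformation law of the Christoffel symbols. In chart [i] the field [coord_vfield c y] has
    as components the differential of the transition applied to [y], and differentiating them
    produces the second derivative. *)
Lemma nabla_coord_chart_at i p a y (c := chart_at A p) : chart_dom i p ->
  to_chart i p (nabla (coord_vfield c a) (coord_vfield c y) p) =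
  'd (fun x => 'd (transition c i) x y) (chart_map c p) a +
  christoffel i p (to_chart i p a) (to_chart i p y).
Proof.
move=> ip; have cp : chart_dom c p := atlas_at SA p.
have CE w := smooth_coord_vfield SA c w.
have Ec w : coord_vfield c w p = w by exact: of_chart_at.
rewrite (nabla_chart (mopen_dom SA c) (CE a) (CE y) cp ip) !Ec; congr (_ + _).
have dt : differentiable (transition i c) (chart_map i p).
  exact: transition_differentiable.
have d2 : differentiable (fun x => 'd (transition c i) x y)
    (transition i c (chart_map i p)).
  rewrite (transition_map SA c ip).
  apply: smooth_on_differentiable (smooth_on_diff y (atlas_overlap SA c i)
     (atlas_transition SA c i)) _ _.
  exact: chart_image_map.
have E x : chart_image i (chart_dom c) x ->
    ((fun x => 'd (transition c i) x y) \o transition i c) x =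
    vfield_coord i (coord_vfield c y) x.
  move=> [q [iq cq] <-] /=.
  by rewrite (transition_map SA c iq) (vfield_coord_map SA _ iq) (to_chart_of SA y cq iq).
apply: etrans (diff_eq_on _ (atlas_overlap SA i c) E (chart_image_map ip cp)
  (differentiable_comp dt d2)) _.
apply: etrans (congr1 (fun h => h (to_chart i p a)) (diff_comp dt d2)) _ => /=.
rewrite (transition_map SA c ip); congr ('d _ _ _).
by rewrite (to_chart_trans SA _ ip cp) to_chart_at.
Qed.

End Connection.

(** * Smooth fields of endomorphisms applied to smooth fields *)

Section Tensors.
Context {R : realType} {m : nat} {M : Type} (A : atlas R m M).
Implicit Types (i j : chart_index A) (p q : M) (U V : set M).
Hypothesis SA : smooth_atlas A.

Lemma endo_family_linear i (J : endofield R m M) x : endo_tensor J ->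
  linear (fun w => vfield_coord i (endo_app J (coord_vfield i w)) x).
Proof.
move=> tJ c v w; rewrite /vfield_coord /endo_app /coord_vfield.
by rewrite linear_of_chart tJ linear_to_chart.
Qed.

Lemma smooth_endo_app U (J : endofield R m M) (X : vfield R m M) : mopen A U ->
  smooth_endo A J -> smooth_vfield A U X -> smooth_vfield A U (endo_app J X).
Proof.
move=> oU [tJ CJ] CX i.
apply: (@smooth_on_eq _ _ _ _ (fun x =>
  vfield_coord i (endo_app J (coord_vfield i (vfield_coord i X x))) x)) => //.
  move=> _ [p [ip Up] <-].
  by rewrite !(vfield_coord_map SA _ ip) /endo_app /coord_vfield to_chartK.
apply: (smooth_on_family (F := fun x w =>
  vfield_coord i (endo_app J (coord_vfield i w)) x)) => //.
- by move=> x _; exact: endo_family_linear.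
- by move=> v; apply: smooth_onW (CJ i v); exact: chart_imageS.
Qed.

End Tensors.

(** * Horizontal and vertical parts, and tensors defined through them *)

Section Frame.
Context {R : realType} {m : nat} {M : Type} (A : atlas R m M).
Implicit Types (i j : chart_index A) (p q : M) (U : set M).
Hypothesis SA : smooth_atlas A.
Variable nabla : vfield R m M -> vfield R m M -> vfield R m M.
Hypothesis LC : linear_connection A nabla.
Let TA := tbundle_atlas A.
Let TM := tbundle R m M.
Implicit Types (u : TM) (h v : 'rV[R]_m) (z : 'rV[R]_(m + m)).

(** The vertical correction of [hlift], with a coordinate field of value [h] in place of [X], so
    that it depends on a vector and not on a field. *)
Definition connection_at u h : 'rV[R]_m :=
  nabla (coord_vfield (chart_at A u.1) h) (coord_vfield (chart_at A u.1) u.2) u.1.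

(* The tangent vector at u with horizontal part h and vertical part v. *)
Definition frame u h v : 'rV[R]_(m + m) := row_mx h (v - connection_at u h).

(** The connection map of [nabla] on the tangent bundle; its kernel is the horizontal subspace. *)
Definition vpart u z : 'rV[R]_m := rsubmx z + connection_at u (lsubmx z).

Lemma connection_at_christoffel u :
  connection_at u = fun h => christoffel nabla (chart_at A u.1) u.1 h u.2.
Proof. by apply/funext => h; rewrite /christoffel to_chart_at. Qed.

Lemma linear_connection_at u : linear (connection_at u).
Proof.
rewrite connection_at_christoffel; apply: christoffel_linear_l => //.
exact: atlas_at.
Qed.

Lemma hpart_frame u h v : lsubmx (frame u h v) = h.
Proof. exact: row_mxKl. Qed.

Lemma vpart_frame u h v : vpart u (frame u h v) = v.
Proof. by rewrite /vpart /frame row_mxKl row_mxKr subrK. Qed.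

Lemma frameK u z : frame u (lsubmx z) (vpart u z) = z.
Proof. by rewrite /frame /vpart addrK hsubmxK. Qed.

Lemma linear_vpart u : linear (vpart u).
Proof.
move=> c z z'; rewrite /vpart !linearP linear_connection_at.
by rewrite scalerDr addrACA.
Qed.

Lemma frame_linear u c h v h' v' :
  frame u (c *: h + h') (c *: v + v') = c *: frame u h v + frame u h' v'.
Proof.
rewrite /frame scale_row_mx add_row_mx linear_connection_at.
by rewrite scalerBr opprD addrACA.
Qed.

Lemma frame0 u : frame u 0 0 = 0.
Proof.
by rewrite /frame (linear_zero (linear_connection_at u)) subr0 row_mx0.
Qed.

Lemma frame_opp u h v : frame u (- h) (- v) = - frame u h v.
Proof.
have := frame_linear u (-1) h v 0 0.
by rewrite frame0 !addr0 !scaleN1r.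
Qed.

(** By tensoriality the horizontal lift sees only the value of [X] at the base point, provided that
    [X] is smooth near it. *)
Lemma hlift_frame U X u : mopen A U -> smooth_vfield A U X -> U u.1 ->
  hlift A nabla X u = frame u (X u.1) 0.
Proof.
move=> oU CX Uu; rewrite /hlift /frame add0r; congr (row_mx _ (- _)).
have cu : chart_dom (chart_at A u.1) u.1 := atlas_at SA u.1.
pose V := U `&` chart_dom (chart_at A u.1).
have oV : mopen A V := mopenI SA oU (mopen_dom SA _).
have Vi : V `<=` chart_dom (chart_at A u.1) by move=> q [].
have VU : V `<=` U by move=> q [].
have CE w := smooth_vfieldW Vi (smooth_coord_vfield SA (chart_at A u.1) w).
apply: (nabla_tensorial SA LC oV (smooth_vfieldW VU CX) (CE _) (CE _)) => //.
by rewrite /coord_vfield of_chart_at.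
Qed.

Lemma vlift_frame X u : vlift X u = frame u 0 (X u.1).
Proof. by rewrite /frame (linear_zero (linear_connection_at u)) subr0. Qed.

(** The second derivative of the transition enters with a plus sign through [tbundle_to_chart] and
    with a minus sign through [connection_at]. Hence a framed vector has the shape
    [(h, v - Gamma(h, y))] in every induced chart. *)
Lemma frame_to_chart i u h v : chart_dom i u.1 ->
  @to_chart _ _ _ TA i u (frame u h v) = row_mx (to_chart i u.1 h)
    (to_chart i u.1 v -
     christoffel nabla i u.1 (to_chart i u.1 h) (to_chart i u.1 u.2)).
Proof.
case: u => p y /= ip; apply: etrans (tbundle_to_chart SA y h _ ip) _.
congr row_mx; have lT := linear_to_chart i p.
rewrite (linear_add lT) (linear_neg lT) /connection_at /=.
rewrite (nabla_coord_chart_at SA LC h y ip) opprD -addrA; congr (_ + _).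
by rewrite [- _ - _]addrC subrK.
Qed.

(** Every vector is framed by its own two parts, so comparing the two blocks in [frame_to_chart] and
    solving for them suffices. *)
Lemma parts_to_chart i u w (z := @of_chart _ _ _ TA i u w) : chart_dom i u.1 ->
  to_chart i u.1 (lsubmx z) = lsubmx w /\
  to_chart i u.1 (vpart u z) = rsubmx w +
    christoffel nabla i u.1 (lsubmx w) (to_chart i u.1 u.2).
Proof.
move=> iu; have zw : @to_chart _ _ _ TA i u z = w.
  exact: (of_chartK (smooth_tbundle_atlas SA) w iu).
move: zw; rewrite -[X in to_chart _ _ X = _](frameK u) frame_to_chart //.
rewrite -[RHS]hsubmxK => /eq_row_mx[-> <-].
by rewrite subrK.
Qed.

Definition frame_endo (H V : M -> 'rV[R]_m -> 'rV[R]_m -> 'rV[R]_m) :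
  endofield R (m + m) TM :=
  fun u z => frame u (H u.1 (lsubmx z) (vpart u z)) (V u.1 (lsubmx z) (vpart u z)).

Lemma frame_endo_frame H V u h v :
  frame_endo H V u (frame u h v) = frame u (H u.1 h v) (V u.1 h v).
Proof. by rewrite /frame_endo hpart_frame vpart_frame. Qed.

Section ChartSmoothness.
Variable i : chart_index A.
Let D := [set z : 'rV[R]_(m + m) | chart_image i setT (lsubmx z)].

Let oD : open D.
Proof. exact: open_tbundle_image (open_chart_image SA i). Qed.

Let D_dom z : D z -> chart_dom i (chart_inv i (lsubmx z)).
Proof. by move=> /(chart_image_inv SA)[]. Qed.

Lemma smooth_on_lsubmx_comp (W : normedModType R) (f : 'rV[R]_m -> W) :
  smooth_on (chart_image i setT) f -> smooth_on D (fun z => f (lsubmx z)).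
Proof. by move=> Cf; apply: smooth_on_comp oD _ (smooth_on_lsubmx oD) Cf. Qed.

(** The principle for smooth linear families is used once per argument, which leaves constant
    arguments. *)
Lemma smooth_on_christoffel (a b : 'rV[R]_(m + m) -> 'rV[R]_m) :
  smooth_on D a -> smooth_on D b ->
  smooth_on D (fun z => christoffel nabla i (chart_inv i (lsubmx z)) (a z) (b z)).
Proof.
move=> Ca Cb; apply: (smooth_on_family
  (F := fun z w => christoffel nabla i (chart_inv i (lsubmx z)) w (b z))) => //.
  by move=> z /D_dom; exact: christoffel_linear_l.
move=> w; apply: (smooth_on_family
  (F := fun z => christoffel nabla i (chart_inv i (lsubmx z)) w)) => //.
  by move=> z /D_dom; exact: christoffel_linear_r.
move=> w'; apply: (smooth_on_lsubmx_comp
  (f := fun x => christoffel nabla i (chart_inv i x) w w')).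
exact: smooth_christoffel.
Qed.

Lemma smooth_on_endo (J : endofield R m M) (a : 'rV[R]_(m + m) -> 'rV[R]_m) :
  smooth_endo A J -> smooth_on D a ->
  smooth_on D (fun z => vfield_coord i (endo_app J (coord_vfield i (a z))) (lsubmx z)).
Proof.
move=> [tJ CJ] Ca; apply: (smooth_on_family (F := fun z w =>
   vfield_coord i (endo_app J (coord_vfield i w)) (lsubmx z))) => //.
  by move=> z _; exact: endo_family_linear.
move=> w; exact: smooth_on_lsubmx_comp (CJ i w).
Qed.

Lemma smooth_on_form (g : formfield R m M) (a b : 'rV[R]_(m + m) -> 'rV[R]_m) :
  smooth_form A g -> smooth_on D a -> smooth_on D b ->
  smooth_on D (fun z => form_app g (coord_vfield i (a z)) (coord_vfield i (b z))
    (chart_inv i (lsubmx z))).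
Proof.
move=> [tg Cg] Ca Cb; apply: (smooth_on_family (W := R^o) (F := fun z w =>
  form_app g (coord_vfield i w) (coord_vfield i (b z)) (chart_inv i (lsubmx z)))) => //.
  move=> z _ c w w'; rewrite /form_app /coord_vfield linear_of_chart.
  exact: (tg _).1.
move=> w; apply: (smooth_on_family (W := R^o) (F := fun z w' =>
  form_app g (coord_vfield i w) (coord_vfield i w') (chart_inv i (lsubmx z)))) => //.
  move=> z _ c w' w''; rewrite /form_app /coord_vfield linear_of_chart.
  exact: (tg _).2.
move=> w'; exact: smooth_on_lsubmx_comp (Cg i w w').
Qed.

End ChartSmoothness.

Lemma tbundle_imageT i : @chart_image _ _ _ TA i setT =
  [set z : 'rV[R]_(m + m) | chart_image i setT (lsubmx z)].
Proof. exact: tbundle_chart_image SA i setT. Qed.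

Lemma endo_to_chart (J : endofield R m M) i p h : chart_dom i p ->
  to_chart i p (J p h) =
  vfield_coord i (endo_app J (coord_vfield i (to_chart i p h))) (chart_map i p).
Proof.
by move=> ip; rewrite (vfield_coord_map SA _ ip) /endo_app /coord_vfield to_chartK.
Qed.

(** [a], [b], [c], [d] are the blocks of a matrix acting on horizontal and vertical parts. In a
    chart, a constant [w] has the parts [hc] and [vc]; the blocks act on these, and [frame_to_chart]
    turns the result back into components. *)
Lemma smooth_frame_endo (a b c d : endofield R m M) H V :
  smooth_endo A a -> smooth_endo A b -> smooth_endo A c -> smooth_endo A d ->
  (forall p h v, H p h v = a p h + b p v) ->
  (forall p h v, V p h v = c p h + d p v) ->
  smooth_endo TA (frame_endo H V).
Proof.
move=> Ca Cb Cc Cd EH EV; split.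
  move=> u k z z'; rewrite /frame_endo !EH !EV linear_vpart [lsubmx _]linearP.
  rewrite (Ca.1 _ _ _ _) (Cb.1 _ _ _ _) (Cc.1 _ _ _ _) (Cd.1 _ _ _ _).
  by rewrite -frame_linear !scalerDr; congr frame; exact: addrACA.
(* The two atlases have convertible index types; the restated goal presents [i] as a chart of
   [M]. *)
suff CE (i : chart_index A) w : smooth_on (@chart_image _ _ _ TA i setT)
    (@vfield_coord _ _ _ TA i (endo_app (frame_endo H V) (@coord_vfield _ _ _ TA i w))).
  by move=> i w; exact: CE.
rewrite tbundle_imageT.
have oD := open_tbundle_image (open_chart_image SA i).
pose hc (z : 'rV[R]_(m + m)) := lsubmx w.
pose vc (z : 'rV[R]_(m + m)) := rsubmx w +
  christoffel nabla i (chart_inv i (lsubmx z)) (hc z) (rsubmx z).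
pose E (J : endofield R m M) (f : 'rV[R]_(m + m) -> 'rV[R]_m) z :=
  vfield_coord i (endo_app J (coord_vfield i (f z))) (lsubmx z).
pose h' z := E a hc z + E b vc z.
pose v' z := E c hc z + E d vc z.
have Chc : smooth_on [set z | chart_image i setT (lsubmx z)] hc by exact: smooth_on_cst.
have Cr := smooth_on_rsubmx oD.
have Cvc : smooth_on [set z | chart_image i setT (lsubmx z)] vc.
  apply: smooth_on_add => //; first exact: smooth_on_cst.
  exact: smooth_on_christoffel.
have Ch' : smooth_on [set z | chart_image i setT (lsubmx z)] h'.
  by apply: smooth_on_add => //; exact: smooth_on_endo.
have Cv' : smooth_on [set z | chart_image i setT (lsubmx z)] v'.
  by apply: smooth_on_add => //; exact: smooth_on_endo.
apply: (@smooth_on_eq _ _ _ _ (fun z => row_mx (h' z)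
  (v' z - christoffel nabla i (chart_inv i (lsubmx z)) (h' z) (rsubmx z)))) => //.
  move=> z Dz; have [ip _ xE] := chart_image_inv SA Dz.
  set p := chart_inv i (lsubmx z) in ip xE.
  pose u : TM := (p, of_chart i p (rsubmx z)).
  have iu : chart_dom i u.1 by [].
  rewrite /vfield_coord /= -/p -/u /endo_app /frame_endo frame_to_chart //.
  have [Eh Ev] := parts_to_chart w iu.
  have yE : to_chart i u.1 u.2 = rsubmx z by exact: of_chartK.
  rewrite yE in Ev *; rewrite !EH !EV !(linear_add (linear_to_chart i _)).
  by rewrite !endo_to_chart // Eh Ev xE.
apply: smooth_on_row_mx => //; apply: smooth_on_add => //.
by apply: smooth_on_opp => //; exact: smooth_on_christoffel.
Qed.

Definition frame_form (g : formfield R m M) : formfield R (m + m) TM :=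
  fun u z z' => g u.1 (lsubmx z) (vpart u z') + g u.1 (vpart u z) (lsubmx z').

Lemma frame_form_frame g u h v h' v' :
  frame_form g u (frame u h v) (frame u h' v') = g u.1 h v' + g u.1 v h'.
Proof. by rewrite /frame_form !hpart_frame !vpart_frame. Qed.

Lemma form_tensor_frame g : form_tensor g -> form_tensor (frame_form g).
Proof.
move=> tg u; split=> w c z z'; rewrite /frame_form linear_vpart;
  have -> : lsubmx (c *: z + z') = c *: lsubmx z + lsubmx z' by rewrite linearP.
  by rewrite !(tg _).1 /= mulrDr addrACA.
by rewrite !(tg _).2 /= mulrDr addrACA.
Qed.

Lemma smooth_frame_form g : smooth_form A g -> smooth_form TA (frame_form g).
Proof.
move=> Cg; split; first exact: form_tensor_frame Cg.1.
suff CE (i : chart_index A) w w' : smooth_on (@chart_image _ _ _ TA i setT)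
    (form_app (frame_form g) (@coord_vfield _ _ _ TA i w) (@coord_vfield _ _ _ TA i w')
       \o @chart_inv _ _ _ TA i).
  by move=> i w w'; exact: CE.
rewrite tbundle_imageT.
have oD := open_tbundle_image (open_chart_image SA i).
pose vc w (z : 'rV[R]_(m + m)) : 'rV[R]_m := rsubmx w +
  christoffel nabla i (chart_inv i (lsubmx z)) (lsubmx w) (rsubmx z).
have Cr := smooth_on_rsubmx oD.
have Cc (a : 'rV[R]_m) :
  smooth_on [set z : 'rV[R]_(m + m) | chart_image i setT (lsubmx z)] (fun=> a).
  exact: smooth_on_cst.
have Cvc k : smooth_on [set z | chart_image i setT (lsubmx z)] (vc k).
  by apply: smooth_on_add => //; exact: smooth_on_christoffel.
pose G a b (z : 'rV[R]_(m + m)) : R^o :=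
  form_app g (coord_vfield i (a z)) (coord_vfield i (b z)) (chart_inv i (lsubmx z)).
apply: (@smooth_on_eq _ _ R^o _ (fun z => G (fun=> lsubmx w) (vc w') z +
   G (vc w) (fun=> lsubmx w') z)) => //; last first.
  by apply: (@smooth_on_add _ _ R^o) => //; exact: smooth_on_form.
move=> z Dz; have [ip _ xE] := chart_image_inv SA Dz.
rewrite /G /=; set p := chart_inv i (lsubmx z) in ip xE *.
pose u : TM := (p, of_chart i p (rsubmx z)).
have iu : chart_dom i u.1 by [].
rewrite [RHS]/form_app -/p -/u /frame_form /form_app /coord_vfield.
have [Eh Ev] := parts_to_chart w iu; have [Eh' Ev'] := parts_to_chart w' iu.
have yE : to_chart i u.1 u.2 = rsubmx z by exact: of_chartK.
rewrite yE /= in Ev Ev'; rewrite /= in Eh Eh'.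
by rewrite /vc -/p -Ev -Ev' -Eh -Eh' !to_chartK.
Qed.

(** Nondegeneracy: pairing with vertical vectors isolates the horizontal part of [z], pairing with
    horizontal ones its vertical part, and [g] is nondegenerate on each. *)
Lemma frame_form_pseudo_riemannian g : pseudo_riemannian A g ->
  pseudo_riemannian TA (frame_form g).
Proof.
move=> Hg; split; first exact: smooth_frame_form (metric_smooth Hg).
  move=> u z z'; rewrite /frame_form addrC.
  by rewrite (Defs.metric_sym Hg _ (vpart u z)) (Defs.metric_sym Hg _ (lsubmx z)).
move=> u z z0; rewrite -(frameK u z).
have [tgl tgr] := (metric_smooth Hg).1 u.1.
have g0 w : g u.1 0 w = 0 := linear_zero (L := fun v => g u.1 v w : R^o) (tgl w).
have g0r w : g u.1 w 0 = 0 := linear_zero (L := g u.1 w : _ -> R^o) (tgr w).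
have -> : lsubmx z = 0.
  apply: (metric_nondeg Hg (p := u.1)) => w; have := z0 (frame u 0 w).
  by rewrite -{1}(frameK u z) frame_form_frame g0r addr0.
have -> : vpart u z = 0.
  apply: (metric_nondeg Hg (p := u.1)) => w; have := z0 (frame u w 0).
  by rewrite -{1}(frameK u z) frame_form_frame g0r add0r.
exact: frame0.
Qed.

Lemma linear_frame_ext (W : lmodType R) (L L' : 'rV[R]_(m + m) -> W) u :
  linear L -> linear L' ->
  (forall h, L (frame u h 0) = L' (frame u h 0)) ->
  (forall v, L (frame u 0 v) = L' (frame u 0 v)) -> L = L'.
Proof.
move=> lL lL' EH EV; apply/funext => z; rewrite -(frameK u z).
have -> : frame u (lsubmx z) (vpart u z) = frame u (lsubmx z) 0 + frame u 0 (vpart u z).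
  by have := frame_linear u 1 (lsubmx z) 0 0 (vpart u z); rewrite !scale1r addr0 add0r.
by rewrite (linear_add lL) (linear_add lL') EH EV.
Qed.

End Frame.

(** * Neutral signature of the lifted metric *)

Section Signature.
Context {R : realType} {m : nat} {M : Type} (A : atlas R m M).
Hypothesis SA : smooth_atlas A.
Variable nabla : vfield R m M -> vfield R m M -> vfield R m M.
Hypothesis LC : linear_connection A nabla.
Variable g : formfield R m M.
Hypothesis Hg : pseudo_riemannian A g.

(** Nondegeneracy makes the Gram matrix invertible. The factor one half compensates for the two
    equal terms by which [frame_form] pairs [(e_i, s_i)] with itself. *)
Lemma half_dual_basis p : exists s : 'I_m -> 'rV[R]_m, forall i j,
  g p (delta_mx 0 i) (s j) = (i == j)%:R / 2.
Proof.
have [tl tr] := (metric_smooth Hg).1 p.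
pose G : 'M[R]_m := \matrix_(i, j) g p (delta_mx 0 i) (delta_mx 0 j).
have gE v w : g p v w = \sum_i v 0 i * g p (delta_mx 0 i) w.
  exact: (linear_row_expand (L := fun v => g p v w : R^o) v (tl w)).
have gE' v w : g p v w = \sum_j w 0 j * g p v (delta_mx 0 j).
  exact: (linear_row_expand (L := g p v : _ -> R^o) w (tr v)).
have uG : G \in unitmx.
  rewrite -row_free_unit; apply/inj_row_free => v vG.
  apply: (metric_nondeg Hg (p := p)) => w; rewrite gE'; apply: big1 => j _.
  rewrite gE; have := congr1 (fun u : 'rV[R]_m => u 0 j) vG; rewrite !mxE => H.
  rewrite [X in _ * X](_ : _ = 0) ?mulr0 // -[RHS]H.
  by apply: eq_bigr => i _; rewrite mxE.
(* Half the rows of the inverse Gram matrix; the symmetry of [g] matches the order of the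
   indices. *)
exists (fun j => 2^-1 *: row j (invmx G)) => i j.
have := congr1 (fun B : 'M[R]_m => B j i) (mulVmx uG); rewrite !mxE eq_sym => <-.
rewrite gE' mulr_suml; apply: eq_bigr => k _; rewrite !mxE (Defs.metric_sym Hg).
by rewrite -mulrA mulrC.
Qed.

(* A basis of signature (m, m): with respect to the horizontal and vertical
   parts, (e_i, s_i) has square 2 g(e_i, s_i) = 1 and (e_i, - s_i) square -1. *)
Lemma frame_form_signature : has_signature (frame_form A nabla g) m m.
Proof.
split=> // u; have [s sP] := half_dual_basis u.1.
have [tl tr] := (metric_smooth Hg).1 u.1.
have sP' i j : g u.1 (s i) (delta_mx 0 j) = (j == i)%:R / 2.
  by rewrite (Defs.metric_sym Hg).
have gN v w : g u.1 v (- w) = - g u.1 v w.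
  exact: (linear_neg (L := g u.1 v : _ -> R^o) (tr v)).
have gN' v w : g u.1 (- v) w = - g u.1 v w.
  exact: (linear_neg (L := fun v => g u.1 v w : R^o) (tl w)).
pose vec (a : 'I_(m + m)) := match fintype.split a with
  | inl i => frame A nabla u (delta_mx 0 i) (s i)
  | inr i => frame A nabla u (delta_mx 0 i) (- s i) end.
have vl i : vec (lshift m i) = frame A nabla u (delta_mx 0 i) (s i).
  by rewrite /vec (unsplitK (inl i)).
have vr i : vec (rshift m i) = frame A nabla u (delta_mx 0 i) (- s i).
  by rewrite /vec (unsplitK (inr i)).
have half (b : bool) : b%:R / 2 + b%:R / 2 = (b%:R : R) by rewrite -splitr.
have vP a b : frame_form A nabla g u (vec a) (vec b) =
    if a == b then (if (a < m)%N then 1 else -1) else 0.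
  case: (split_ordP a) => i ->; case: (split_ordP b) => j ->;
    rewrite ?vl ?vr frame_form_frame ?gN ?gN' sP sP'
      ?eq_lshift ?eq_rshift ?eq_lrshift ?eq_rlshift /= [j == i]eq_sym.
  - by rewrite half; case: eqP.
  - by rewrite addNr.
  - by rewrite subrr.
  - by rewrite -opprD half; case: eqP; rewrite ?oppr0.
exists (\matrix_a vec a); split; last by move=> a b; rewrite !rowK.
(* Orthogonal vectors of square 1 or -1 are independent: pairing a vanishing combination with
   [vec b] leaves its coefficient at [b] up to sign. *)
rewrite -row_free_unit; apply/inj_row_free => v vP0.
apply/rowP => b; rewrite [RHS]mxE.
have [tl' _] := form_tensor_frame SA LC (metric_smooth Hg).1 u.
have := linear_zero (L := fun z => frame_form A nabla g u z (vec b) : R^o) (tl' _).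
rewrite -vP0 mulmx_sum_row.
rewrite (linear_expand _ _ _ (L := fun z => frame_form A nabla g u z (vec b) : R^o) (tl' _)).
rewrite (bigD1 b) //= big1 ?addr0 => [|a ab].
  rewrite rowK vP eqxx; case: ifP => _ /eqP; rewrite mulf_eq0.
    by rewrite oner_eq0 orbF => /eqP.
  by rewrite oppr_eq0 oner_eq0 orbF => /eqP.
by rewrite rowK vP (negbTE ab) scaler0.
Qed.

End Signature.

(** * The lifted structure: existence, uniqueness and algebraic identities *)

Section Lifts.
Context {R : realType} {m : nat} {M : Type} (A : atlas R m M).
Hypothesis SA : smooth_atlas A.
Variable nabla : vfield R m M -> vfield R m M -> vfield R m M.
Hypothesis LC : linear_connection A nabla.

Lemma smooth_endo_id : smooth_endo A (fun p v => v).
Proof.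
split=> [p c v w|i w]; first by [].
rewrite chart_imageT; exact: (smooth_coord_vfield SA i w i).
Qed.

Lemma smooth_endo_scale (c : R) (J : endofield R m M) :
  smooth_endo A J -> smooth_endo A (fun p v => c *: J p v).
Proof.
move=> [tJ CJ]; split=> [p k v w|i w].
  by rewrite tJ scalerDr !scalerA mulrC.
have oU := mopenT SA.
have CX : smooth_vfield A (chart_dom i) (endo_app J (coord_vfield i w)).
  apply: (smooth_endo_app SA) (smooth_coord_vfield SA i w) => //.
  exact: mopen_dom.
rewrite chart_imageT.
exact: (smooth_vfield_scale (mopen_dom SA i) (smooth_fun_cst c (mopen_dom SA i)) CX i).
Qed.

Lemma smooth_endo_zero : smooth_endo A (fun p v => 0).
Proof.
have -> : (fun (p : M) (v : 'rV[R]_m) => 0) = (fun p v => 0 *: v) :> endofield R m M.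
  by apply/funext => p; apply/funext => v; rewrite scale0r.
exact: smooth_endo_scale smooth_endo_id.
Qed.

Lemma smooth_endo_opp (J : endofield R m M) :
  smooth_endo A J -> smooth_endo A (fun p v => - J p v).
Proof.
have -> : (fun p v => - J p v) = (fun p v => (-1) *: J p v).
  by apply/funext => p; apply/funext => v; rewrite scaleN1r.
exact: smooth_endo_scale.
Qed.

Variables (J : endofield R m M) (g : formfield R m M).
Hypothesis CJ : almost_complex A J.
Hypothesis Hg : pseudo_riemannian A g.
Hypothesis gJ : forall p v w, g p (J p v) (J p w) = - g p v w.

(** The prescribed values on lifts force the blocks: [J1] is diagonal with entries [-J] and [J],
    [J2] is the rotation of the two parts, and [J3] exchanges them while applying [J]. *)
Let J1 := frame_endo A nabla (fun p h v => - J p h) (fun p h v => J p v).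
Let J2 := frame_endo A nabla (fun p h v => - v) (fun p h v => h).
Let J3 := frame_endo A nabla (fun p h v => J p v) (fun p h v => J p h).
Let gh := frame_form A nabla g.
Let TA := tbundle_atlas A.

Let J_opp p v : J p (- v) = - J p v.
Proof. exact: linear_neg (CJ.1.1 p) v. Qed.

Let J_zero p : J p 0 = 0.
Proof. exact: linear_zero (CJ.1.1 p). Qed.

Lemma smooth_J1 : smooth_endo TA J1.
Proof.
apply: (smooth_frame_endo SA LC (smooth_endo_opp CJ.1) smooth_endo_zero
  smooth_endo_zero CJ.1) => p h v; by rewrite ?addr0 ?add0r.
Qed.

Lemma smooth_J2 : smooth_endo TA J2.
Proof.
apply: (smooth_frame_endo SA LC smooth_endo_zero (smooth_endo_opp smooth_endo_id)
  smooth_endo_id smooth_endo_zero) => p h v; by rewrite ?addr0 ?add0r.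
Qed.

Lemma smooth_J3 : smooth_endo TA J3.
Proof.
apply: (smooth_frame_endo SA LC smooth_endo_zero CJ.1 CJ.1 smooth_endo_zero)
  => p h v; by rewrite ?addr0 ?add0r.
Qed.

Lemma lifted_structure_frame : lifted_structure A nabla J g J1 J2 J3 gh.
Proof.
split; try exact: smooth_J1.1; try exact: smooth_J2.1; try exact: smooth_J3.1.
- by have := form_tensor_frame SA LC (metric_smooth Hg).1.
(* The lift of [J X] also occurs, and [hlift_frame] requires that field to be smooth. *)
- move=> U X oU CX u Uu; have CJX := smooth_endo_app SA oU CJ.1 CX.
  rewrite !(hlift_frame SA LC oU _ Uu) // !(vlift_frame SA LC).
  rewrite /J1 /J2 /J3 !frame_endo_frame -!frame_opp //.
  by rewrite !J_zero !oppr0.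
- move=> U X Y oU CX CY u Uu.
  rewrite !(hlift_frame SA LC oU _ Uu) // !(vlift_frame SA LC).
  have [tl tr] := (metric_smooth Hg).1 u.1.
  have g0 w : g u.1 0 w = 0 := linear_zero (L := fun v => g u.1 v w : R^o) (tl w).
  have g0r w : g u.1 w 0 = 0 := linear_zero (L := g u.1 w : _ -> R^o) (tr w).
  by rewrite /gh !frame_form_frame !g0 !g0r ?addr0 ?add0r.
Qed.

(** At [u], each purely horizontal or vertical vector is the lift of a coordinate field of the
    preferred chart, smooth on its domain. The prescribed values thus fix the tensors on a spanning
    set. *)
Lemma lifted_structure_unique K1 K2 K3 kh K1' K2' K3' kh' :
  lifted_structure A nabla J g K1 K2 K3 kh ->
  lifted_structure A nabla J g K1' K2' K3' kh' ->
  [/\ K1' = K1, K2' = K2, K3' = K3 & kh' = kh].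
Proof.
move=> L L'.
have CE i w := smooth_coord_vfield SA i w.
have hE u h : frame A nabla u h 0 = hlift A nabla (coord_vfield (chart_at A u.1) h) u.
  rewrite (hlift_frame SA LC (mopen_dom SA _) (CE _ _) (atlas_at SA _)).
  by rewrite /coord_vfield of_chart_at.
have vE u v : frame A nabla u 0 v = vlift (coord_vfield (chart_at A u.1) v) u.
  by rewrite (vlift_frame SA LC) /coord_vfield of_chart_at.
have LJ u w := lifted_J L (mopen_dom SA _) (CE (chart_at A u.1) w) (atlas_at SA u.1).
have LJ' u w := lifted_J L' (mopen_dom SA _) (CE (chart_at A u.1) w) (atlas_at SA u.1).
split; apply/funext => u.
- apply: (linear_frame_ext SA LC (u := u)) => [||h|v];
    [exact: lifted_J1_tensor L' u|exact: lifted_J1_tensor L u| |].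
    by rewrite hE; have [[-> _] _ _] := LJ u h; have [[-> _] _ _] := LJ' u h.
  by rewrite vE; have [[_ ->] _ _] := LJ u v; have [[_ ->] _ _] := LJ' u v.
- apply: (linear_frame_ext SA LC (u := u)) => [||h|v];
    [exact: lifted_J2_tensor L' u|exact: lifted_J2_tensor L u| |].
    by rewrite hE; have [_ [-> _] _] := LJ u h; have [_ [-> _] _] := LJ' u h.
  by rewrite vE; have [_ [_ ->] _] := LJ u v; have [_ [_ ->] _] := LJ' u v.
- apply: (linear_frame_ext SA LC (u := u)) => [||h|v];
    [exact: lifted_J3_tensor L' u|exact: lifted_J3_tensor L u| |].
    by rewrite hE; have [_ _ [-> _]] := LJ u h; have [_ _ [-> _]] := LJ' u h.
  by rewrite vE; have [_ _ [_ ->]] := LJ u v; have [_ _ [_ ->]] := LJ' u v.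
have Lg v w := lifted_metric L (mopen_dom SA _) (CE (chart_at A u.1) v)
  (CE (chart_at A u.1) w) (atlas_at SA u.1).
have Lg' v w := lifted_metric L' (mopen_dom SA _) (CE (chart_at A u.1) v)
  (CE (chart_at A u.1) w) (atlas_at SA u.1).
have [tl tr] := lifted_metric_tensor L u; have [tl' tr'] := lifted_metric_tensor L' u.
apply/funext => z; apply: (linear_frame_ext (W := R^o) SA LC (u := u)) => [||h|v];
  [exact: tr'|exact: tr| |].
  (* The second slot is now a lift; the first slot is reduced in the same way with the second held
     fixed. *)
  apply: (@congr1 _ _ (fun f : 'rV[R]_(m + m) -> R^o => f z)
    (fun z => kh' u z _) (fun z => kh u z _)).
  apply: (linear_frame_ext SA LC (u := u)) => [||h'|v'];
    [exact: tl'|exact: tl| |].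
    by rewrite !hE; have [-> _ _ _] := Lg h' h; have [-> _ _ _] := Lg' h' h.
  by rewrite vE hE; have [_ _ _ ->] := Lg v' h; have [_ _ _ ->] := Lg' v' h.
apply: (@congr1 _ _ (fun f : 'rV[R]_(m + m) -> R^o => f z)
  (fun z => kh' u z _) (fun z => kh u z _)).
apply: (linear_frame_ext SA LC (u := u)) => [||h'|v'];
  [exact: tl'|exact: tl| |].
  by rewrite vE hE; have [_ _ -> _] := Lg h' v; have [_ _ -> _] := Lg' h' v.
by rewrite !vE; have [_ -> _ _] := Lg v' v; have [_ -> _ _] := Lg' v' v.
Qed.

Lemma frame_almost_hypercomplex : almost_hypercomplex TA J1 J2 J3.
Proof.
have JJ := CJ.2.
have eqT (f f' : 'rV[R]_(m + m) -> 'rV[R]_(m + m)) u :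
    (forall h v, f (frame A nabla u h v) = f' (frame A nabla u h v)) -> forall z, f z = f' z.
  by move=> E z; rewrite -(frameK A nabla u z).
split; [split; first exact: smooth_J1|split; first exact: smooth_J2|
  split; first exact: smooth_J3| | | |];
  move=> u; apply: (eqT _ _ u) => h v;
  rewrite /J1 /J2 /J3 !frame_endo_frame -?frame_opp //;
  by rewrite ?J_opp ?JJ ?opprK ?J_opp ?JJ ?opprK.
Qed.

(** For [J1] the sign in [g(J., J.) = - g] cancels against that of its block [-J], giving an
    isometry; for [J3] it survives, and for [J2] the sign comes from the block [-1]. *)
Lemma frame_hermitian_norden n : m = (2 * n)%N ->
  hermitian_norden_metric n TA J1 J2 J3 gh.
Proof.
move=> mn.
have gN u v w : g u v (- w) = - g u v w.
  exact: (linear_neg (L := g u v : _ -> R^o) (((metric_smooth Hg).1 u).2 v)).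
have gN' u v w : g u (- v) w = - g u v w.
  exact: (linear_neg (L := fun v => g u v w : R^o) (((metric_smooth Hg).1 u).1 w)).
split.
- exact: frame_form_pseudo_riemannian.
- by rewrite -mn; exact: frame_form_signature.
- move=> u z z'; rewrite -(frameK A nabla u z) -(frameK A nabla u z').
  by rewrite /J1 /gh !frame_endo_frame !frame_form_frame gN gN' !gJ !opprK.
- move=> u z z'; rewrite -(frameK A nabla u z) -(frameK A nabla u z').
  rewrite /J2 /gh !frame_endo_frame !frame_form_frame gN gN'.
  by rewrite -opprD opprK addrC.
- move=> u z z'; rewrite -(frameK A nabla u z) -(frameK A nabla u z').
  rewrite /J3 /gh !frame_endo_frame !frame_form_frame !gJ.
  by rewrite -opprD opprK addrC.
Qed.

End Lifts.

Theorem theorem3p6 (R : realType) (n : nat) (M : Type)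
    (A : atlas R (2 * n) M) (J : endofield R (2 * n) M)
    (g gt : formfield R (2 * n) M)
    (nabla : vfield R (2 * n) M -> vfield R (2 * n) M -> vfield R (2 * n) M) :
  almost_norden A J g gt ->
  levi_civita A g nabla ->
  exists (J1 J2 J3 : endofield R (2 * n + 2 * n) (tbundle R (2 * n) M))
         (gh : formfield R (2 * n + 2 * n) (tbundle R (2 * n) M)),
    [/\ lifted_structure A nabla J g J1 J2 J3 gh,
        (forall J1' J2' J3' gh', lifted_structure A nabla J g J1' J2' J3' gh' ->
           [/\ J1' = J1, J2' = J2, J3' = J3 & gh' = gh])
      & almost_hypercomplex_hermitian_norden n (tbundle_atlas A) J1 J2 J3
          gh (first_arg_form J1 gh) (first_arg_form J2 gh)
          (first_arg_form J3 gh)].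
Proof.
move=> [SM CJ Hg gJ _] [LC _ _]; have SA := smooth_manifold_atlas SM.
exists (frame_endo A nabla (fun p h v => - J p h) (fun p h v => J p v)).
exists (frame_endo A nabla (fun p h v => - v) (fun p h v => h)).
exists (frame_endo A nabla (fun p h v => J p v) (fun p h v => J p h)).
exists (frame_form A nabla g).
have LS := lifted_structure_frame SA LC CJ Hg.
split=> //.
  by move=> K1 K2 K3 kh H; have := lifted_structure_unique SA LC LS H.
split=> //.
- exact: tbundle_manifold.
- by rewrite -mulnDl.
- exact: frame_almost_hypercomplex.
- exact: frame_hermitian_norden.
Qed.
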